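(* Let $A$ be a finite dimensional algebra over a field $k$. Then $A$ is brick finite if and only if there exists $M\in\mathsf{mod}\,A$ such that the $M$-TF equivalence coincides with the TF equivalence.
   Context: $\mathcal{A}:=\mathsf{mod}\,A$ is the category of finitely generated right $A$-modules, with isoclasses of simple modules $S(1),\ldots,S(n)$. A brick is a nonzero module all of whose nonzero endomorphisms are isomorphisms; $A$ is brick finite if there are only finitely many isoclasses of bricks in $\mathsf{mod}\,A$. $K_0(\mathcal{A})_{\mathbb{R}}=K_0(\mathcal{A})\otimes_{\mathbb{Z}}\mathbb{R}=\bigoplus_{i=1}^n\mathbb{R}[S(i)]$ and $K_0(\mathcal{A})_{\mathbb{R}}^*=\operatorname{Hom}_{\mathbb{R}}(K_0(\mathcal{A})_{\mathbb{R}},\mathbb{R})$ (identified with $K_0(\mathsf{proj}\,A)_{\mathbb{R}}$ via the Euler form $\langle[P],[X]\rangle=\dim_k\operatorname{Hom}_A(P,X)$). For $\theta\in K_0(\mathcal{A})_{\mathbb{R}}^*$ and $X\in\mathcal{A}$, write $\theta(X):=\theta([X])$. Semistable torsion pairs. For $\theta\in K_0(\mathcal{A})_{\mathbb{R}}^*$ define full subcategories of $\mathcal{A}$: $\overline{\mathcal{T}}_\theta$ = objects $X$ with $\theta(N)\ge0$ for every factor object $N$ of $X$; $\mathcal{F}_\theta$ = objects $X$ with $\theta(L)<0$ for every nonzero subobject $L$ of $X$; $\mathcal{T}_\theta$ = objects $X$ with $\theta(N)>0$ for every nonzero factor object $N$ of $X$; $\overline{\mathcal{F}}_\theta$ = objects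 $X$ with $\theta(L)\le0$ for every subobject $L$ of $X$. Then $(\overline{\mathcal{T}}_\theta,\mathcal{F}_\theta)$ and $(\mathcal{T}_\theta,\overline{\mathcal{F}}_\theta)$ are torsion pairs, and $\mathcal{W}_\theta:=\overline{\mathcal{T}}_\theta\cap\overline{\mathcal{F}}_\theta$ is a wide subcategory of $\mathcal{A}$, which is an abelian category of finite length. For $M\in\mathcal{A}$, $\overline{\mathrm{t}}_\theta M$ (resp. $\mathrm{t}_\theta M$) is the largest subobject of $M$ lying in $\overline{\mathcal{T}}_\theta$ (resp. $\mathcal{T}_\theta$), $\mathrm{f}_\theta M:=M/\overline{\mathrm{t}}_\theta M$, $\overline{\mathrm{f}}_\theta M:=M/\mathrm{t}_\theta M$, $\mathrm{w}_\theta M:=\overline{\mathrm{t}}_\theta M/\mathrm{t}_\theta M\in\mathcal{W}_\theta$. For $X\in\mathcal{W}_\theta$, $\mathsf{supp}_\theta X$ is the set of isoclasses of composition factors of $X$ in $\mathcal{W}_\theta$. TF equivalence on $K_0(\mathcal{A})_{\mathbb{R}}^*$: $\theta,\eta$ are TF equivalent if $(\overline{\mathcal{T}}_\theta,\mathcal{F}_\theta)=(\overline{\mathcal{T}}_\eta,\mathcal{F}_\eta)$ and $(\mathcal{T}_\theta,\overline{\mathcal{F}}_\theta)=(\mathcal{T}_\eta,\overline{\mathcal{F}}_\eta)$. $M$-TF equivalence on $K_0(\mathcal{A})_{\mathbb{R}}^*$: $\theta,\eta$ are $M$-TF equivalent if (i) $\mathrm{t}_\theta M=\mathrm{t}_\eta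 M$, $\mathrm{w}_\theta M=\mathrm{w}_\eta M$, $\mathrm{f}_\theta M=\mathrm{f}_\eta M$ (equivalently $\mathrm{t}_\theta M=\mathrm{t}_\eta M$ and $\overline{\mathrm{t}}_\theta M=\overline{\mathrm{t}}_\eta M$ as subobjects of $M$), and (ii) $\mathsf{supp}_\theta(\mathrm{w}_\theta M)=\mathsf{supp}_\eta(\mathrm{w}_\eta M)$. *)

(* Defs.v *)
From mathcomp Require Import all_boot all_order all_algebra all_field.
From mathcomp Require Import reals.

Set Implicit Arguments.
Unset Strict Implicit.
Unset Printing Implicit Defensive.

Import GRing.Theory Num.Theory.
Local Open Scope ring_scope.

(* A right A-module is a left module over the opposite ring A^c: the scalar
   action [a *: x] stands for x . a. *)
Definition finitely_generated (B : pzRingType) (V : lmodType B) : Prop :=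
  exists (n : nat) (g : 'I_n -> V),
    forall x : V, exists c : 'I_n -> B, x = \sum_(i < n) c i *: g i.

Record fgmod (k : fieldType) (A : falgType k) := FGMod {
  fgmod_carrier :> lmodType A^c ;
  fgmodP : finitely_generated fgmod_carrier
}.

Section Category.
Variables (k : fieldType) (A : falgType k).
Implicit Types X Y Z M N S W : fgmod A.

Definition is_zero X : Prop := forall x : X, x = 0.

Definition surjective X Y (f : {linear X -> Y}) : Prop :=
  forall y : Y, exists x : X, f x = y.

Definition iso X Y : Prop := exists f : {linear X -> Y}, bijective f.

Definition exact_at X Y Z (f : {linear X -> Y}) (g : {linear Y -> Z}) : Prop :=
  forall y : Y, g y = 0 <-> exists x : X, f x = y.

Definition short_exact X Y Z (f : {linear X -> Y}) (g : {linear Y -> Z}) :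
    Prop :=
  [/\ injective f, exact_at f g & surjective g].

Record subobj M := SubObj {
  sub_dom :> fgmod A ;
  sub_incl : {linear sub_dom -> M} ;
  sub_inj : injective sub_incl
}.

Record factobj M := FactObj {
  fact_cod :> fgmod A ;
  fact_proj : {linear M -> fact_cod} ;
  fact_surj : surjective fact_proj
}.

Definition sub_le M (L L' : subobj M) : Prop :=
  forall x : L, exists x' : L', sub_incl L' x' = sub_incl L x.

Definition largest_sub (C : fgmod A -> Prop) M (L : subobj M) : Prop :=
  C L /\ (forall L' : subobj M, C L' -> sub_le L' L).

(* W is (a model of) the quotient L' / L of two subobjects L <= L' of M. *)
Definition is_subquotient M (L L' : subobj M) W : Prop :=
  exists (f : {linear L -> L'}) (p : {linear L' -> W}),
    (forall x : L, sub_incl L' (f x) = sub_incl L x) /\ short_exact f p.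

Definition brick S : Prop :=
  ~ is_zero S /\
  (forall f : {linear S -> S}, (exists x : S, f x <> 0) -> bijective f).

Definition brick_finite : Prop :=
  exists (n : nat) (B : 'I_n -> fgmod A),
    forall S, brick S -> exists i : 'I_n, iso S (B i).

(* Simple objects, and composition series, of a full subcategory C of mod A.
   For a wide subcategory C the monomorphisms of C are the injective maps
   between objects of C, and the cokernels of C are those of mod A. *)
Definition simple_in (C : fgmod A -> Prop) S : Prop :=
  [/\ C S, ~ is_zero S &
      forall L : subobj S, C L -> is_zero L \/ bijective (sub_incl L)].

(* The list contains the composition factors, from top to bottom. *)
Inductive comp_series (C : fgmod A -> Prop) :
    fgmod A -> seq (fgmod A) -> Prop :=
| comp_series_nil X : C X -> is_zero X -> comp_series C X [::]
| comp_series_cons X Y S (f : {linear Y -> X}) (g : {linear X -> S}) s :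
    C X -> short_exact f g -> simple_in C S -> comp_series C Y s ->
    comp_series C X (S :: s).

(* [comp_series] asks for exact sequences with any model of each factor, so
   this predicate is invariant under isomorphism in S. *)
Definition comp_factor (C : fgmod A -> Prop) X S : Prop :=
  exists s1 s2 : seq (fgmod A), comp_series C X (s1 ++ S :: s2).

End Category.

Arguments brick_finite {k} A.

(* The Grothendieck group K_0(mod A) is generated by the classes [X] subject to
   [Y] = [X] + [Z] for each short exact sequence 0 -> X -> Y -> Z -> 0, so that
   Hom_R(K_0(mod A) (x)_Z R, R) = Hom_Z(K_0(mod A), R) is the set of real-valued
   functions that are additive on short exact sequences. *)
Record K0dual (R : realType) (k : fieldType) (A : falgType k) := K0Dual {
  K0eval :> fgmod A -> R ;
  K0_additive : forall (X Y Z : fgmod A)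
    (f : {linear X -> Y}) (g : {linear Y -> Z}),
    short_exact f g -> K0eval Y = K0eval X + K0eval Z
}.

Section Semistable.
Variables (R : realType) (k : fieldType) (A : falgType k).
Implicit Types (theta eta : K0dual R A) (X M S W : fgmod A).

Definition Tbar theta X : Prop := forall N : factobj X, 0 <= theta N.

Definition Ftors theta X : Prop :=
  forall L : subobj X, ~ is_zero L -> theta L < 0.

Definition Ttors theta X : Prop :=
  forall N : factobj X, ~ is_zero N -> 0 < theta N.

Definition Fbar theta X : Prop := forall L : subobj X, theta L <= 0.

Definition Wss theta X : Prop := Tbar theta X /\ Fbar theta X.

Definition supp theta X : fgmod A -> Prop := comp_factor (Wss theta) X.

Definition is_t theta M (L : subobj M) : Prop := largest_sub (Ttors theta) L.

Definition is_tbar theta M (L : subobj M) : Prop := largest_sub (Tbar theta) L.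

Definition TF_equiv theta eta : Prop :=
  forall X, [/\ Tbar theta X <-> Tbar eta X, Ftors theta X <-> Ftors eta X,
                Ttors theta X <-> Ttors eta X & Fbar theta X <-> Fbar eta X].

(* The largest subobjects are unique as subobjects of M, so asking for common
   witnesses L, Lbar amounts to t_theta M = t_eta M and tbar_theta M =
   tbar_eta M; W is then w_theta M = w_eta M = Lbar / L. *)
Definition MTF_equiv M theta eta : Prop :=
  exists (L Lbar : subobj M) (W : fgmod A),
    [/\ is_t theta L /\ is_t eta L,
        is_tbar theta Lbar /\ is_tbar eta Lbar,
        is_subquotient L Lbar W &
        forall S, supp theta W S <-> supp eta W S].

End Semistable.

(* Main.v *)
(* If the bricks are finitely many, let [M] be their sum. If [T] is not
   contained in [T2], for torsion pairs [(T, F)] and [(T2, F2)], then a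
   nonzero object of minimal dimension in the intersection of [T] and [F2]
   is a brick in [T] but not in [T2]; and bricks being summands of [M], the
   torsion parts of [M] detect which bricks are torsion.

   Conversely, call chamber a torsion pair [(T, F)] with an integral
   functional [w] that is positive on [T] and negative on [F]. Then [w] is
   positive on the tilted heart [F[1] * T], which therefore has finite
   length. Suppose the signed classes of its simple objects have a dual
   basis, as is the case for [T = mod A] by Jordan-Holder. For a simple [X]
   in [T] with dual functional [g], moving [w] in the direction [- g]
   reaches a wall [eta]; beyond it lie the functionals [m eta - g]. A given
   object of [T_eta], or of [Fbar_eta], is torsion, or torsion-free, for
   all of them with [m] large; applied to the two parts of [M] this makes
   them [M]-TF equivalent for large [m], hence TF equivalent. So a single
   one of them defines a chamber with torsion class [T_eta], which consists
   of the [Z] in [T] with [Hom(Z, X) = 0], and the heart of this chamber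
   again has a dual basis. The torsion part of [M] has strictly decreased.
   A brick in [T] either lies in one of these finitely many smaller torsion
   classes, or maps nontrivially to every simple [X] in [T]; in that case
   [T] is the smallest torsion class containing it, which determines the
   brick. Induction on the dimension of the torsion part of [M] bounds the
   number of bricks. *)
Require Import Defs.
From HB Require Import structures.
From mathcomp Require Import all_boot all_order all_algebra all_field.
From mathcomp Require Import generic_quotient ring_quotient boolp reals zify.

Set Implicit Arguments.
Unset Strict Implicit.
Unset Printing Implicit Defensive.

Import GRing.Theory Num.Theory Order.TTheory.
Local Open Scope ring_scope.

(** * Submodules, quotients and finite-dimensional images *)

Section LmoduleConstructions.
Variables (B : pzRingType) (M : lmodType B).

Record submodule := Submodule {
  submodule_pred : {pred M};
  submodule0 : 0 \in submodule_pred;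
  submoduleP : forall a, {in submodule_pred &, forall x y,
    a *: x + y \in submodule_pred} }.

Variable S : submodule.

Fact submodule_zmod_closed : zmod_closed (submodule_pred S).
Proof.
split; first exact: submodule0.
by move=> x y xS yS; rewrite addrC -scaleN1r; apply: submoduleP.
Qed.
Fact submodule_scaler_closed : GRing.scaler_closed (submodule_pred S).
Proof.
by move=> a x xS; rewrite -[a *: x]addr0; apply: submoduleP;
  rewrite ?submodule0.
Qed.
HB.instance Definition _ := GRing.isZmodClosed.Build M (submodule_pred S)
  submodule_zmod_closed.
HB.instance Definition _ := GRing.isScaleClosed.Build B M (submodule_pred S)
  submodule_scaler_closed.

Record lsub := LSub { lsub_val : M; _ : lsub_val \in submodule_pred S }.
HB.instance Definition _ := [isSub for lsub_val].
HB.instance Definition _ := [Choice of lsub by <:].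
HB.instance Definition _ := [SubChoice_isSubZmodule of lsub by <:].
HB.instance Definition _ := [SubZmodule_isSubLmodule of lsub by <:].

Local Open Scope quotient_scope.
Definition lquot := Quotient.quot (submodule_pred S).
HB.instance Definition _ := GRing.Zmodule.on lquot.
HB.instance Definition _ := ZmodQuotient.on lquot.

Definition lquot_scale (a : B) (x : lquot) : lquot := \pi_(lquot) (a *: repr x).

Lemma lquot_piP (x y : M) :
  (\pi_(lquot) x = \pi_(lquot) y) <-> (x - y \in submodule_pred S).
Proof. by rewrite Quotient.idealrBE; split=> /eqP. Qed.

Lemma lquot_scaleE a (x : M) :
  lquot_scale a (\pi_(lquot) x) = \pi_(lquot) (a *: x).
Proof.
apply/lquot_piP; rewrite -scalerBr; apply: rpredZ.
by apply/lquot_piP; rewrite reprK.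
Qed.

Fact lquot_scalerA a b x :
  lquot_scale a (lquot_scale b x) = lquot_scale (a * b) x.
Proof. by elim/quotW: x => x;
  rewrite (lquot_scaleE b x) !lquot_scaleE scalerA. Qed.
Fact lquot_scale1r : left_id 1 lquot_scale.
Proof. by elim/quotW=> x; rewrite lquot_scaleE scale1r. Qed.
Lemma lquot_piD (x y : M) : \pi_(lquot) (x + y) = \pi_(lquot) x + \pi_(lquot) y.
Proof. exact: Quotient.pi_add. Qed.

Fact lquot_scalerDr : right_distributive lquot_scale +%R.
Proof.
move=> a; elim/quotW=> x; elim/quotW=> y.
by rewrite -lquot_piD !lquot_scaleE scalerDr lquot_piD.
Qed.
Fact lquot_scalerDl x : {morph lquot_scale^~ x: a b / a + b}.
Proof. by elim/quotW: x => x a b; rewrite !lquot_scaleE scalerDl lquot_piD. Qed.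
HB.instance Definition _ := GRing.Zmodule_isLmodule.Build B lquot
  lquot_scalerA lquot_scale1r lquot_scalerDr lquot_scalerDl.

Definition lquot_pi (x : M) : lquot := \pi_(lquot) x.
Fact lquot_pi_linear : linear lquot_pi.
Proof. by move=> a x y; rewrite /lquot_pi lquot_piD -lquot_scaleE. Qed.
HB.instance Definition _ := GRing.isLinear.Build B M lquot *:%R lquot_pi
  lquot_pi_linear.

Lemma lquot_pi_surj (y : lquot) : exists x, lquot_pi x = y.
Proof. by exists (repr y); rewrite /lquot_pi reprK. Qed.

Lemma lquot_pi_eq0 x : (lquot_pi x = 0) <-> (x \in submodule_pred S).
Proof.
have -> : 0 = lquot_pi 0 by rewrite (raddf0 (lquot_pi : {linear M -> lquot})).
by rewrite lquot_piP subr0.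
Qed.
End LmoduleConstructions.

Section VectConstructions.
Import VectorInternalTheory.
Variables (k : fieldType) (V : vectType k).

(** A subspace of largest dimension inside [P] exhausts [P]: together with a vector of [P] outside
    it, it would span a larger one. *)
Lemma vspace_of_pred (P : V -> Prop) :
  P 0 -> (forall (c : k) x y, P x -> P y -> P (c *: x + y)) ->
  exists U : {vspace V}, forall x, x \in U <-> P x.
Proof.
move=> P0 PL.
pose Q d := `[< exists2 U : {vspace V}, (forall x, x \in U -> P x) &
  \dim U = d >].
have exQ : exists d, Q d.
  by exists 0%N; apply/asboolP; exists 0%VS; rewrite ?dimv0 // => x;
    rewrite memv0 => /eqP->.
have bQ d : Q d -> (d <= \dim {:V})%N.
  by move=> /asboolP[U _ <-]; apply/dimvS/subvf.
case: (ex_maxnP exQ bQ) => d /asboolP[U UP dU] dmax.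
exists U => x; split=> [/UP//|Px].
apply: contrapT => xU.
have: (\dim (U + <[x]>)%VS <= d)%N.
  apply: dmax; apply/asboolP;
    eexists=> // y /memv_addP[u uU [v /vlineP[c ->] ->]].
  by rewrite addrC; apply: PL => //; apply: UP.
rewrite -dU; have /dimv_leqif_sup : (U <= U + <[x]>)%VS by apply: addvSl.
move=> [h1 h2] h3; apply: xU; have :
  (U + <[x]> <= U)%VS by rewrite -h2 eqn_leq h1.
by move/subvP; apply; apply: subvP (addvSr _ _) _ (memv_line _).
Qed.

(** A complement of the kernel maps bijectively onto [W], so its coordinates serve for [W]. *)
Lemma fin_dim_image (W : lmodType k) (f : {linear V -> W}) :
  (forall w, exists v, f v = w) -> exists n, inhabited (Vector.axiom n W).
Proof.
move=> fs.
have [|c x y|U UP] := @vspace_of_pred (fun v => f v = 0); first exact: raddf0.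
  by move=> fx fy; rewrite linearP fx fy scaler0 addr0.
pose C := (U^C)%VS.
have Cinj x y : x \in C -> y \in C -> f x = f y -> x = y.
  move=> xC yC e; apply/eqP; rewrite -subr_eq0 -memv0 -(capv_compl U) memv_cap.
  by rewrite (rpredB xC yC) andbT; apply/UP; rewrite /= raddfB /= e subrr.
have Csurj w : exists c, c \in C /\ f c = w.
  have [v <-] := fs w.
  have : v \in (U + C)%VS by rewrite addv_complf memvf.
  move=> /memv_addP[u uU [c cC ->]]; exists c; split=> //.
  by move/UP: uU => uU; rewrite raddfD /= uU add0r.
have [s sP] := choice Csurj.
have slin : linear s.
  move=> a x y; apply: Cinj; rewrite ?linearP /=; try exact: (proj1 (sP _)).
    by apply: rpredD; rewrite ?rpredZ //; exact: (proj1 (sP _)).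
  by rewrite !(proj2 (sP _)).
pose h w : subvs_of C := vsproj C (s w).
have hbij : bijective h.
  exists (fun c => f (vsval c)) => [w|c].
    by rewrite /h vsprojK ?(proj2 (sP _)) ?(proj1 (sP _)).
  apply: val_inj; rewrite /= /h vsprojK ?(proj1 (sP _)) //.
  by apply: Cinj; rewrite ?(proj1 (sP _)) ?(proj2 (sP _)) ?subvsP.
have vbij : bijective (@v2r _ (subvs_of C)).
  by exists (@r2v _ (subvs_of C)); [apply: v2rK|apply: r2vK].
exists (dim (subvs_of C)); constructor; exists (v2r \o h).
  by move=> a x y; rewrite /= /h slin !linearP.
exact: (bij_comp vbij hbij).
Qed.
End VectConstructions.

(** * Dimension over the base field *)

Section Dimension.
Variables (k : fieldType) (A : falgType k).

(** A type alias, so that the action of [k] through [c%:A] does not compete with the action of [A^c]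
    on the same carrier. *)
Definition kmod (M : fgmod A) : Type := M.

Section KStructure.
Variable M : fgmod A.
HB.instance Definition _ := GRing.Zmodule.on (kmod M).
Definition kmod_scale (c : k) (x : kmod M) : kmod M := (c%:A : A^c) *: (x : M).

Fact kmod_scalerA a b x : kmod_scale a (kmod_scale b x) = kmod_scale (a * b) x.
Proof.
rewrite /kmod_scale scalerA; congr (_ *: _).
by rewrite -[LHS]/((b%:A : A) * a%:A) -scalerAl mul1r scalerA mulrC.
Qed.
Fact kmod_scale1r : left_id 1 kmod_scale.
Proof. by move=> x; rewrite /kmod_scale scale1r -[RHS]scale1r. Qed.
Fact kmod_scalerDr : right_distributive kmod_scale +%R.
Proof. by move=> a x y; rewrite /kmod_scale -scalerDr. Qed.
Fact kmod_scalerDl x : {morph kmod_scale^~ x: a b / a + b}.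
Proof. by move=> a b; rewrite /kmod_scale scalerDl; apply: scalerDl. Qed.
HB.instance Definition _ := GRing.Zmodule_isLmodule.Build k (kmod M)
  kmod_scalerA kmod_scale1r kmod_scalerDr kmod_scalerDl.

(** Generators over [A] present the module as an image of a power of [A]. The dependent pair under
    [exists] lets [cid] extract dimension and coordinates as data for the instance below. *)
Fact kmod_fin_dim : exists s : {n : nat & Vector.axiom n (kmod M)}, True.
Proof.
have [n [g gP]] := fgmodP M.
pose phi (c : {ffun 'I_n -> A}) : kmod M := \sum_(i < n) (c i : A^c) *: g i.
have phil : linear phi.
  move=> a c d; rewrite /phi.
  transitivity (\sum_(i < n) ((a%:A : A^c) *: ((c i : A^c) *: g i)
                 + (d i : A^c) *: g i)).
    apply: eq_bigr => i _; rewrite !ffunE scalerA.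
    have -> : (a%:A : A^c) * c i = a *: (c i : A).
      by rewrite -[LHS]/((c i : A) * a%:A) -scalerAr mulr1.
    exact: (scalerDl (g i) ((a *: (c i : A)) : A^c) (d i : A^c)).
  by rewrite big_split /= -scaler_sumr.
pose h := GRing.isLinear.Build _ _ _ _ phi phil.
pose F : {linear _ -> _} := HB.pack phi h.
have [|m [am]] := @fin_dim_image _ _ _ F; last by exists (existT _ m am).
move=> w; have [c ->] := gP w; exists [ffun i => c i].
by rewrite /= /phi; apply: eq_bigr => i _; rewrite ffunE.
Qed.
HB.instance Definition _ :=
  Lmodule_hasFinDim.Build k (kmod M) (projT2 (projT1 (cid kmod_fin_dim))).

Definition mdim : nat := \dim {:kmod M}.
End KStructure.

Implicit Types X Y Z M N L : fgmod A.

Definition klin X Y (f : {linear X -> Y}) : kmod X -> kmod Y := f.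
Fact klin_linear X Y (f : {linear X -> Y}) : linear (klin f).
Proof. by move=> a x y; rewrite /klin [LHS]linearP. Qed.
HB.instance Definition _ X Y (f : {linear X -> Y}) :=
  GRing.isLinear.Build k (kmod X) (kmod Y) *:%R (klin f) (klin_linear f).

Lemma mdim_exact X Y Z (f : {linear X -> Y}) (g : {linear Y -> Z}) :
  short_exact f g -> mdim Y = (mdim X + mdim Z)%N.
Proof.
move=> [fi fg gs].
pose F := linfun (klin f); pose G := linfun (klin g).
have FE x : F x = f x by rewrite lfunE.
have GE x : G x = g x by rewrite lfunE.
have eF : \dim (limg F) = mdim X.
  rewrite limg_dim_eq //; apply/eqP; rewrite -subv0; apply/subvP => x.
  rewrite memv_cap memvf memv_ker memv0 FE => /eqP fx; apply/eqP/fi.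
  by rewrite fx raddf0.
have eG : limg G = fullv.
  apply/vspaceP => z; rewrite memvf.
  by have [y <-] := gs z; rewrite -GE memv_img ?memvf.
have eFG : lker G = limg F.
  apply/vspaceP => y; rewrite memv_ker GE;
    apply/eqP/memv_imgP => [/fg[x <-]|[x _ ->]].
    by exists x; rewrite ?memvf ?FE.
  by apply/fg; exists x; rewrite FE.
have := limg_ker_dim G fullv; rewrite capfv eFG eF.
by rewrite eG.
Qed.

Lemma mdim0 X : mdim X = 0%N <-> is_zero X.
Proof.
rewrite /mdim; split=> [/eqP|X0].
  rewrite dimv_eq0 => /eqP e x; apply/eqP.
  by have := memvf (x : kmod X); rewrite e memv0.
apply/eqP; rewrite dimv_eq0 -subv0; apply/subvP => x _.
by rewrite memv0; apply/eqP/X0.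
Qed.

Lemma submodule_exists M (P : M -> Prop) :
  P 0 -> (forall a x y, P x -> P y -> P (a *: x + y)) ->
  exists L (i : {linear L -> M}), injective i /\ forall y, P y <-> exists x,
    i x = y.
Proof.
move=> P0 PL.
pose PP : {pred M} := fun x => `[<P x>].
have h0 : 0 \in PP by apply/asboolP.
have hL : forall a, {in PP &, forall x y, a *: x + y \in PP}.
  by move=> a x y /asboolP Px /asboolP Py; apply/asboolP/PL.
pose S := Submodule h0 hL.
have fgS : finitely_generated (lsub S).
  have [|a x y Px Py|U UP] := @vspace_of_pred k (kmod M) P; first exact: P0.
    exact: (PL (a%:A : A^c)).
  (* The index is unbounded: past the end of the basis [nth] yields 0, which lies in the submodule
     too. A basis over [k] then generates over [A]. *)
  have bP i : ((vbasis U)`_i : M) \in PP.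
    apply/asboolP/UP; have [ilt|ige] := ltnP i (size (vbasis U)).
      by apply: vbasis_mem; apply: mem_nth.
    by rewrite nth_default ?mem0v.
  exists (\dim U), (fun i : 'I_(\dim U) => @LSub _ _ S _ (bP i)) => x.
  have xU : (lsub_val x : kmod M) \in U by apply/UP/asboolP; apply: (valP x).
  exists (fun i => (coord (vbasis U) i (lsub_val x))%:A).
  apply: val_inj; rewrite raddf_sum /= [LHS](coord_vbasis xU).
  by apply: eq_bigr => i _.
exists (FGMod fgS), (\val : {linear lsub S -> M}); split; first exact: val_inj.
move=> y; split=> [Py|[x <-]]; last by apply/asboolP; apply: (valP x).
by have hy : y \in submodule_pred S by [apply/asboolP]; exists (LSub hy).
Qed.

Lemma quotient_exists M (P : M -> Prop) :
  P 0 -> (forall a x y, P x -> P y -> P (a *: x + y)) ->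
  exists N (p : {linear M -> N}), surjective p /\ forall x, p x = 0 <-> P x.
Proof.
move=> P0 PL.
pose PP : {pred M} := fun x => `[<P x>].
have h0 : 0 \in PP by apply/asboolP.
have hL : forall a, {in PP &, forall x y, a *: x + y \in PP}.
  by move=> a x y /asboolP Px /asboolP Py; apply/asboolP/PL.
pose S := Submodule h0 hL.
have sS := @lquot_pi_surj _ _ S.
have fgS : finitely_generated (lquot S).
  have [n [g gP]] := fgmodP M.
  exists n, (fun i => lquot_pi S (g i)) => y; have [x <-] := sS y.
  have [c ->] := gP x; exists c; rewrite raddf_sum.
  apply: eq_bigr => i _. exact: linearZ.
exists (FGMod fgS), (lquot_pi S : {linear M -> lquot S}); split;
  first exact: sS.
move=> x; split=> [/lquot_pi_eq0/asboolP//|Px].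
by apply/lquot_pi_eq0/asboolP.
Qed.
End Dimension.

(** * Kernels, cokernels, pullbacks and pushouts *)

Section Maps.
Variables (k : fieldType) (A : falgType k).
Implicit Types X Y Z M N L E Q I K C : fgmod A.

Definition nonzero_map X Y (f : {linear X -> Y}) : Prop := exists x, f x <> 0.

Lemma zero_mapP X Y (f : {linear X -> Y}) :
  ~ nonzero_map f -> forall x, f x = 0.
Proof. by move=> nf x; apply: contrapT => fx; apply: nf; exists x. Qed.

Lemma not_zeroP X : ~ is_zero X -> exists x : X, x <> 0.
Proof. by move=> nX; apply: contrapT => h; apply: nX => x;
  apply: contrapT => xn; apply: h; exists x. Qed.

(** Maps are handled up to pointwise equality: this lemma and the next ones give a bundled map
    together with an equation for its values. *)
Lemma linear_exists X Y (h : X -> Y) :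
  (forall a x y, h (a *: x + y) = a *: h x + h y) ->
  exists f : {linear X -> Y}, f =1 h.
Proof.
move=> hl; pose hh := GRing.isLinear.Build _ _ _ _ h hl.
by pose F : {linear X -> Y} := HB.pack h hh; exists F.
Qed.

Lemma comp_exists X Y Z (g : {linear Y -> Z}) (f : {linear X -> Y}) :
  exists h : {linear X -> Z}, forall x, h x = g (f x).
Proof. by apply: linear_exists => a x y; rewrite !linearP. Qed.

Lemma id_exists X : exists h : {linear X -> X}, forall x, h x = x.
Proof. exact: linear_exists. Qed.

Lemma zero_exists X Y : exists h : {linear X -> Y}, forall x, h x = 0.
Proof. by apply: linear_exists => a x y; rewrite scaler0 addr0. Qed.

Lemma linear_inj X Y (f : {linear X -> Y}) :
  (forall x, f x = 0 -> x = 0) -> injective f.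
Proof.
move=> fi x y e; apply/eqP; rewrite -subr_eq0; apply/eqP/fi.
by rewrite raddfB /= e subrr.
Qed.

Lemma inj_eq0 X Y (f : {linear X -> Y}) x : injective f -> f x = 0 -> x = 0.
Proof. by move=> fi e; apply: fi; rewrite e raddf0. Qed.

Lemma bij_injsurj X Y (f : {linear X -> Y}) :
  injective f -> surjective f -> bijective f.
Proof.
move=> fi fs; have [g gP] := choice fs.
by exists g => [x|y]; [apply: fi|]; rewrite gP.
Qed.

Lemma bij_surj X Y (f : {linear X -> Y}) : bijective f -> surjective f.
Proof. by move=> [g _ gK] y; exists (g y). Qed.

Lemma factor_surj M Q Z (p : {linear M -> Q}) (f : {linear M -> Z}) :
  surjective p -> (forall x, p x = 0 -> f x = 0) ->
  exists h : {linear Q -> Z}, forall x, h (p x) = f x.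
Proof.
move=> ps pf; have [s sP] := choice ps.
have fE x y : p x = p y -> f x = f y.
  move=> e; apply/eqP; rewrite -subr_eq0 -raddfB; apply/eqP/pf.
  by rewrite raddfB /= e subrr.
have [|h hE] := @linear_exists Q Z (fun q => f (s q)).
  by move=> a x y; rewrite -linearP; apply: fE; rewrite linearP !sP.
by exists h => x; rewrite hE; apply: fE; rewrite sP.
Qed.

Lemma lift_inj L M Z (i : {linear L -> M}) (f : {linear Z -> M}) :
  injective i -> (forall z, exists x, i x = f z) ->
  exists h : {linear Z -> L}, forall z, i (h z) = f z.
Proof.
move=> ii /choice[s sP].
have [|h hE] := @linear_exists Z L s; last by exists h => z; rewrite hE.
by move=> a x y; apply: ii; rewrite linearP !sP linearP.
Qed.

Lemma iso_refl X : iso X X.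
Proof.
have [h hE] := id_exists X; exists h; apply: bij_injsurj => [x y|x].
  by rewrite !hE.
by exists x.
Qed.

Lemma iso_trans X Y Z : iso X Y -> iso Y Z -> iso X Z.
Proof.
move=> [f fb] [g gb]; have [h hE] := comp_exists g f; exists h.
by apply: (eq_bij (bij_comp gb fb)) => x; rewrite /= hE.
Qed.

Lemma iso_sym X Y : iso X Y -> iso Y X.
Proof.
move=> [f [g fK gK]].
have [|h hE] := @linear_exists Y X g.
  by move=> a x y; rewrite -[RHS]fK linearP !gK.
by exists h; exists f => x; rewrite hE.
Qed.

Lemma iso_is_zero X Y : iso X Y -> is_zero X -> is_zero Y.
Proof. by move=> [f /bij_surj fs] X0 y; have [x <-] := fs y;
  rewrite (X0 x) raddf0. Qed.

Lemma kernel_exists X Y (f : {linear X -> Y}) :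
  exists s : {K : fgmod A & {linear K -> X}},
    injective (projT2 s) /\ exact_at (projT2 s) f.
Proof.
have [||K [i [ii iP]]] := @submodule_exists _ _ X (fun x => f x = 0).
- exact: raddf0.
- by move=> a x y fx fy; rewrite linearP fx fy scaler0 addr0.
by exists (existT _ K i).
Qed.

Definition kerm X Y (f : {linear X -> Y}) :=
  projT1 (projT1 (cid (kernel_exists f))).
Definition kinc X Y (f : {linear X -> Y}) : {linear kerm f -> X} :=
  projT2 (projT1 (cid (kernel_exists f))).

Lemma kinc_inj X Y (f : {linear X -> Y}) : injective (kinc f).
Proof. exact: (proj1 (projT2 (cid (kernel_exists f)))). Qed.
Lemma kincP X Y (f : {linear X -> Y}) x : f x = 0 <-> exists y, kinc f y = x.
Proof. exact: (proj2 (projT2 (cid (kernel_exists f)))). Qed.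
Lemma kincE X Y (f : {linear X -> Y}) y : f (kinc f y) = 0.
Proof. by apply/kincP; exists y. Qed.

Lemma coker_exists X Y (f : {linear X -> Y}) :
  exists s : {K : fgmod A & {linear Y -> K}},
    surjective (projT2 s) /\ exact_at f (projT2 s).
Proof.
have [||K [i [ii iP]]] := @quotient_exists _ _ Y (fun y => exists x, f x = y).
- by exists 0; rewrite raddf0.
- by move=> a x y [x' <-] [y' <-]; exists (a *: x' + y'); rewrite linearP.
by exists (existT _ K i).
Qed.

Definition cokm X Y (f : {linear X -> Y}) :=
  projT1 (projT1 (cid (coker_exists f))).
Definition cprj X Y (f : {linear X -> Y}) : {linear Y -> cokm f} :=
  projT2 (projT1 (cid (coker_exists f))).

Lemma cprj_surj X Y (f : {linear X -> Y}) : surjective (cprj f).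
Proof. exact: (proj1 (projT2 (cid (coker_exists f)))). Qed.
Lemma cprjP X Y (f : {linear X -> Y}) y : cprj f y = 0 <-> exists x, f x = y.
Proof. exact: (proj2 (projT2 (cid (coker_exists f)))). Qed.
Lemma cprjE X Y (f : {linear X -> Y}) x : cprj f (f x) = 0.
Proof. by apply/cprjP; exists x. Qed.

Lemma image_exists X Y (f : {linear X -> Y}) :
  exists I (p : {linear X -> I}) (i : {linear I -> Y}),
    [/\ surjective p, injective i & forall x, i (p x) = f x].
Proof.
pose p := cprj (kinc f).
have [|i iE] := @factor_surj _ _ _ p f (@cprj_surj _ _ (kinc f)).
  by move=> x /cprjP[y <-]; apply: kincE.
exists _, p, i; split=> //; first exact: cprj_surj.
apply: linear_inj => q; have [x <-] := cprj_surj q; rewrite iE.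
by move=> /kincP[y <-]; apply: cprjE.
Qed.

Lemma ses_ker X Y (f : {linear X -> Y}) :
  surjective f -> short_exact (kinc f) f.
Proof. by split=> //; [apply: kinc_inj | move=> y; apply: kincP]. Qed.

Lemma ses_coker X Y (f : {linear X -> Y}) :
  injective f -> short_exact f (cprj f).
Proof. by split=> //; [move=> y; apply: cprjP|apply: cprj_surj]. Qed.

Lemma kerm_zero X Y (f : {linear X -> Y}) : is_zero (kerm f) <-> injective f.
Proof.
split=> [K0|fi y]; last by apply: kinc_inj; apply: fi; rewrite kincE !raddf0.
by apply: linear_inj => x /kincP[y <-]; rewrite (K0 y) raddf0.
Qed.

Lemma cokm_zero X Y (f : {linear X -> Y}) : is_zero (cokm f) <-> surjective f.
Proof.
split=> [C0 y|fs y]; first by apply/cprjP; apply: C0.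
by have [z <-] := cprj_surj y; apply/cprjP; apply: fs.
Qed.

Lemma dsum_fg X Y : finitely_generated (X * Y)%type.
Proof.
have [n [g gP]] := fgmodP X; have [m [h hP]] := fgmodP Y.
exists (n + m)%N, (fun i => match split i with inl i => (g i,
  0) | inr j => (0, h j) end).
move=> [x y]; have [c ->] := gP x; have [d ->] := hP y.
exists (fun i => match split i with inl i => c i | inr j => d j end).
rewrite big_split_ord /=.
have sl i : split (lshift m i) = inl i :> 'I_n + 'I_m := unsplitK (inl i).
have sr i : split (rshift n i) = inr i :> 'I_n + 'I_m := unsplitK (inr i).
under [X in _ = X + _]eq_bigr => i _ do rewrite sl.
under [X in _ = _ + X]eq_bigr => i _ do rewrite sr.
rewrite [LHS]surjective_pairing [RHS]surjective_pairing /=; congr (_, _).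
  rewrite !raddf_sum /= [X in _ + X]big1 ?addr0 // => i _.
  exact: scaler0.
rewrite !raddf_sum /= [X in X + _]big1 ?add0r // => i _.
exact: scaler0.
Qed.

Definition dsum X Y : fgmod A := FGMod (@dsum_fg X Y).

Lemma pullback_exists X Y Z (f : {linear X -> Z}) (g : {linear Y -> Z}) :
  exists E (p : {linear E -> X}) (q : {linear E -> Y}),
   [/\ forall e, f (p e) = g (q e),
       forall x y, f x = g y -> exists e, p e = x /\ q e = y &
       forall e, p e = 0 -> q e = 0 -> e = 0].
Proof.
have [||E [i [ii iP]]] :=
  @submodule_exists _ _ (dsum X Y) (fun e => f e.1 = g e.2).
- by rewrite /= !raddf0.
- by move=> a [x y] [x' y'] /= e e'; rewrite !linearP e e'.
have [p pE] : exists p : {linear E -> X}, forall e, p e = (i e).1.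
  by apply: linear_exists => a x y; rewrite linearP.
have [q qE] : exists q : {linear E -> Y}, forall e, q e = (i e).2.
  by apply: linear_exists => a x y; rewrite linearP.
exists E, p, q; split=> [e|x y fg|e].
- by rewrite pE qE; apply/iP; exists e.
- have [|e eE] := proj1 (iP (x, y)); first by [].
  by exists e; rewrite pE qE eE.
rewrite pE qE => e1 e2; apply: (inj_eq0 ii).
by rewrite [LHS]surjective_pairing e1 e2.
Qed.

Lemma pushout_exists X Y Z (f : {linear Z -> X}) (g : {linear Z -> Y}) :
  exists E (i : {linear X -> E}) (j : {linear Y -> E}),
   [/\ forall z, i (f z) = j (g z),
       forall e, exists x y, e = i x + j y &
       forall x y, i x = j y -> exists z, x = f z /\ y = g z].
Proof.
have [||E [p [ps pP]]] := @quotient_exists _ _ (dsum X Y)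
    (fun e => exists z, e.1 = f z /\ e.2 = - g z).
- by exists 0; split; rewrite !raddf0 ?oppr0.
- move=> a [x y] [x' y'] [z [/= -> ->]] [z' [/= -> ->]]; exists (a *: z + z').
  by rewrite /= !linearP.
have [i iE] : exists i : {linear X -> E}, forall x, i x = p (x, 0).
  apply: linear_exists => a x y; rewrite -linearP; congr (p _).
  by congr (_, _); rewrite /= scaler0 addr0.
have [j jE] : exists j : {linear Y -> E}, forall x, j x = p (0, x).
  apply: linear_exists => a x y; rewrite -linearP; congr (p _).
  by congr (_, _); rewrite /= scaler0 addr0.
exists E, i, j; split=> [z|e|x y].
- apply/eqP; rewrite iE jE -subr_eq0 -raddfB; apply/eqP/pP; exists z => /=.
  by rewrite subr0 sub0r.
- have [[x y] <-] := ps e; exists x, y; rewrite iE jE -raddfD; congr (p _).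
  by congr (_, _); rewrite /= ?addr0 ?add0r.
move=> /eqP; rewrite iE jE -subr_eq0 -raddfB => /eqP/pP[z /= [e1 e2]].
exists z; split; first by rewrite -e1 subr0.
by apply: oppr_inj; rewrite -e2 sub0r.
Qed.
End Maps.

(** * Functions additive on short exact sequences *)

Section AdditiveFunctions.
Variables (k : fieldType) (A : falgType k).
Implicit Types X Y Z M N L E Q I K C : fgmod A.

Definition ses_additive (V : zmodType) (h : fgmod A -> V) : Prop :=
  forall X Y Z (f : {linear X -> Y}) (g : {linear Y -> Z}),
    short_exact f g -> h Y = h X + h Z.

Section Theory.
Variables (V : zmodType) (h : fgmod A -> V).
Hypothesis hA : ses_additive h.

Lemma additive_zero X : is_zero X -> h X = 0.
Proof.
move=> X0; have [f fE] := id_exists X.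
have : short_exact f f.
  split=> [x y|y|y]; first by rewrite !fE.
  - by rewrite fE; split=> [->|_]; [exists 0; rewrite raddf0|exact: X0].
  - by exists y.
by move/hA/eqP; rewrite -subr_eq subrr eq_sym => /eqP.
Qed.

Lemma additive_inj X Y (f : {linear X -> Y}) : injective f ->
  h Y = h X + h (cokm f).
Proof. by move=> /ses_coker/hA. Qed.

Lemma additive_surj X Y (f : {linear X -> Y}) : surjective f ->
  h X = h (kerm f) + h Y.
Proof. by move=> /ses_ker/hA. Qed.

Lemma additive_iso X Y : iso X Y -> h X = h Y.
Proof.
move=> [f fb]; rewrite (additive_surj (bij_surj fb)) additive_zero ?add0r //.
by apply/kerm_zero; apply: bij_inj.
Qed.

(** Both sides are the sum of [h] over kernel, image and cokernel. This is the main source of weight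
    comparisons in the heart. *)
Lemma additive_map X Y (f : {linear X -> Y}) :
  h X + h (cokm f) = h (kerm f) + h Y.
Proof.
have [I [p [i [ps ii ip]]]] := image_exists f.
have -> : h X = h (kerm f) + h I.
  apply: (hA (f := kinc f) (g := p)); split=> //; first exact: kinc_inj.
  move=> x; rewrite -kincP -ip; split=> [->|/(inj_eq0 ii)//]; exact: raddf0.
rewrite -addrA; congr (_ + _); symmetry.
apply: (hA (f := i) (g := cprj f)); split=> //; last exact: cprj_surj.
move=> y; rewrite cprjP; split=> [[x <-]|[z <-]]; first by exists (p x).
by have [x <-] := ps z; exists x; rewrite ip.
Qed.
End Theory.

Lemma mdim_additive : ses_additive (fun X => (mdim X)%:Z).
Proof. by move=> X Y Z f g /mdim_exact ->; rewrite PoszD. Qed.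

Lemma mdim_gt0 X : ~ is_zero X -> (0 < mdim X)%N.
Proof. by move=> nX; rewrite lt0n; apply/eqP => /mdim0. Qed.

Lemma mdim_iso X Y : iso X Y -> mdim X = mdim Y.
Proof. by move=> /(additive_iso mdim_additive)[]. Qed.

Lemma mdim_inj X Y (f : {linear X -> Y}) :
  injective f -> (mdim Y = mdim X + mdim (cokm f))%N.
Proof. by move=> /ses_coker/mdim_exact. Qed.

Lemma mdim_surj X Y (f : {linear X -> Y}) :
  surjective f -> (mdim X = mdim (kerm f) + mdim Y)%N.
Proof. by move=> /ses_ker/mdim_exact. Qed.

Lemma inj_dim_surj X Y (f : {linear X -> Y}) :
  injective f -> (mdim Y <= mdim X)%N -> surjective f.
Proof. by move=> /mdim_inj e h; apply/cokm_zero/mdim0; lia. Qed.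

Lemma surj_dim_inj X Y (f : {linear X -> Y}) :
  surjective f -> (mdim X <= mdim Y)%N -> injective f.
Proof. by move=> /mdim_surj e h; apply/kerm_zero/mdim0; lia. Qed.
End AdditiveFunctions.

(** * Torsion pairs *)

Section TorsionPairs.
Variables (k : fieldType) (A : falgType k).
Implicit Types X Y Z M N L E Q I K C D W : fgmod A.

Lemma min_measure (m : fgmod A -> nat) (P : fgmod A -> Prop) :
  (exists X, P X) -> exists X, P X /\ forall Y, P Y -> (m X <= m Y)%N.
Proof.
move=> [X0 PX0].
have exQ : exists d, `[<exists2 X, P X & m X = d>].
  by exists (m X0); apply/asboolP; exists X0.
case: (ex_minnP exQ) => d /asboolP[X PX <-] dmin; exists X; split=> // Y PY.
by apply: dmin; apply/asboolP; exists Y.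
Qed.

Lemma max_measure (m : fgmod A -> nat) (P : fgmod A -> Prop) (b : nat) :
  (exists X, P X) -> (forall X, P X -> (m X <= b)%N) ->
  exists X, P X /\ forall Y, P Y -> (m Y <= m X)%N.
Proof.
move=> [X0 PX0] bP.
have exQ : exists d, `[<exists2 X, P X & m X = d>].
  by exists (m X0); apply/asboolP; exists X0.
have bQ d : `[<exists2 X, P X & m X = d>] -> (d <= b)%N.
  by move=> /asboolP[X /bP + <-].
case: (ex_maxnP exQ bQ) => d /asboolP[X PX <-] dmax; exists X; split=> // Y PY.
by apply: dmax; apply/asboolP; exists Y.
Qed.

(** The image of [X] in [N] is a quotient of [X], and the rest of [N] is a quotient of [Z];
    positivity on quotients thus passes to extensions. *)
Lemma ses_quotient X Y Z N (f : {linear X -> Y}) (g : {linear Y -> Z})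
    (p : {linear Y -> N}) : short_exact f g -> surjective p ->
  exists I C (a : {linear X -> I}) (i : {linear I -> N}) (c : {linear N -> C})
    (b : {linear Z -> C}), [/\ surjective a, surjective b & short_exact i c].
Proof.
move=> [fi fg gs] ps.
have [pf pfE] := comp_exists p f.
have [I [a [i [sa ii ai]]]] := image_exists pf.
have [cp cpE] := comp_exists (cprj i) p.
have [|b bE] := @factor_surj _ _ _ _ _ g cp gs.
  by move=> y /fg[x <-]; rewrite cpE -pfE -ai cprjE.
exists I, (cokm i), a, i, (cprj i), b; split=> //; last exact: ses_coker.
move=> c; have [n <-] := cprj_surj c; have [y <-] := ps n.
by exists (g y); rewrite bE cpE.
Qed.

Lemma ses_pullback X Y Z E (f : {linear X -> Y}) (g : {linear Y -> Z})
    (j : {linear E -> Z}) : short_exact f g ->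
  exists D (a : {linear D -> Y}) (b : {linear X -> D}) (q : {linear D -> E}),
    [/\ short_exact b q, forall x, g (a x) = j (q x), forall x, a (b x) = f x,
        injective j -> injective a &
        forall x, a x = 0 -> q x = 0 -> x = 0].
Proof.
move=> [fi fg gs]; have [D [a [q [aq Ds D0]]]] := pullback_exists g j.
(* The map [X -> D] sends [x] to the element of the pullback with components [f x] and 0. *)
have [b0 [b1 b2]] : exists b : X -> D, (forall x,
  a (b x) = f x) /\ (forall x, q (b x) = 0).
  have /choice[b bP] : forall x, exists e, a e = f x /\ q e = 0.
    by move=> x; apply: Ds; rewrite raddf0; apply/fg; exists x.
  by exists b; split=> x; have [] := bP x.
have [|b bE] := @linear_exists _ _ X D b0.
  move=> c x y; apply/eqP; rewrite -subr_eq0; apply/eqP/D0.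
    by rewrite raddfB /= linearP /= !b1 linearP subrr.
  by rewrite raddfB /= linearP /= !b2 scaler0 addr0 subr0.
exists D, a, b, q; split=> //.
- split; first by move=> x y; rewrite !bE => e; apply: fi; rewrite -!b1 e.
    move=> e; split=> [qe|[x <-]]; last by rewrite bE b2.
    have [x xE] : exists x, f x = a e by apply/fg; rewrite aq qe raddf0.
    exists x; apply/eqP; rewrite -subr_eq0; apply/eqP/D0; rewrite raddfB /= bE.
      by rewrite b1 xE subrr.
    by rewrite b2 qe subrr.
  move=> e; have [y yE] := gs (j e); have [x [_ xE]] := Ds _ _ yE.
  by exists x.
- by move=> x; rewrite bE b1.
move=> ji; apply: linear_inj => x ax; apply: D0 => //.
by apply: (inj_eq0 ji); rewrite -aq ax raddf0.
Qed.

Lemma ses_pushout X Y Z W (f : {linear X -> Y}) (g : {linear Y -> Z})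
    (h : {linear X -> W}) : short_exact f g ->
  exists D (a : {linear Y -> D}) (b : {linear W -> D}) (q : {linear D -> Z})
    (c : {linear cokm h -> cokm a}),
    [/\ short_exact b q, forall y, q (a y) = g y, surjective c &
        injective h -> injective a].
Proof.
move=> [fi fg gs]; have [D [a [b [ab Ds Di]]]] := pushout_exists f h.
have bi : injective b.
  apply: linear_inj => x bx.
  have [z [/esym/(inj_eq0 fi) -> ->]] : exists z, 0 = f z /\ x = h z.
    by apply: Di; rewrite raddf0.
  by rewrite raddf0.
pose rep e := projT1 (cid (Ds e)).
have Dn x y x' y' : a x + b y = a x' + b y' -> g x = g x'.
  move=> e; have /Di[z [xz _]] : a (x - x') = b (y' - y).
    apply/eqP; rewrite !raddfB /= subr_eq addrAC eq_sym subr_eq.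
    by rewrite [b y' + _]addrC -e.
  apply/eqP; rewrite -subr_eq0 -raddfB; apply/eqP/fg; exists z; exact/esym.
(* Every element of the pushout is some [a x + b y]; [x] is not unique, but [g x] is, by [Dn]. *)
have /choice[q0 q0P] : forall e, exists z, forall x y, e = a x + b y -> z = g x.
  by move=> e; have [x [y ->]] := Ds e; exists (g x) => x' y'; apply: Dn.
have [|q qE] := @linear_exists _ _ D Z q0.
  move=> c e e'; have [x [y eE]] := Ds e; have [x' [y' e'E]] := Ds e'.
  rewrite (q0P _ _ _ eE) (q0P _ _ _ e'E) -linearP;
    apply: (q0P _ _ (c *: y + y')).
  by rewrite eE e'E !linearP /= scalerDr addrACA.
have qab x y : q (a x + b y) = g x by rewrite qE; apply: q0P.
have qa x : q (a x) = g x by rewrite -[a x]addr0 -[0](raddf0 b) qab.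
have qb x : q (b x) = 0 by rewrite -[b x]add0r -[0](raddf0 a) qab raddf0.
have [cb cbE] := comp_exists (cprj a) b.
have [|c cE] := @factor_surj _ _ _ _ _ (cprj h) cb (@cprj_surj _ _ _ _ h).
  by move=> x /cprjP[z <-]; rewrite cbE -ab cprjE.
exists D, a, b, q, c; split=> //.
  split=> // [e|z]; last by have [y <-] := gs z; exists (a y).
  split=> [|[x <-]]; last exact: qb.
  have [x [y ->]] := Ds e; rewrite qab => /fg[z <-].
  by exists (h z + y); rewrite raddfD /= -ab.
  move=> d; have [e <-] := cprj_surj d; have [x [y ->]] := Ds e.
  by exists (cprj h y); rewrite cE cbE raddfD /= cprjE add0r.
move=> hi; apply: linear_inj => y ay.
have [z [-> /esym/(inj_eq0 hi) ->]] : exists z, y = f z /\ 0 = h z.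
  by apply: Di; rewrite raddf0.
exact: raddf0.
Qed.

Lemma kerm_iso X Y Z (i : {linear X -> Y}) (f : {linear Y -> Z}) :
  injective i -> exact_at i f -> iso X (kerm f).
Proof.
move=> ii fi; have [|h hE] :=
  @lift_inj _ _ _ _ _ (kinc f) i (@kinc_inj _ _ _ _ f).
  by move=> x; apply/kincP/fi; exists x.
exists h; apply: bij_injsurj => [x y e|y].
  by apply: ii; rewrite -!hE e.
have /fi[x xE] := kincE y; exists x; apply: (@kinc_inj _ _ _ _ f).
by rewrite hE.
Qed.

Lemma cokm_iso X Y Z (f : {linear X -> Y}) (p : {linear Y -> Z}) :
  surjective p -> exact_at f p -> iso (cokm f) Z.
Proof.
move=> ps fp; have [|h hE] :=
  @factor_surj _ _ _ _ _ (cprj f) p (@cprj_surj _ _ _ _ f).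
  by move=> x /cprjP/fp.
exists h; apply: bij_injsurj; last first.
  by move=> z; have [y <-] := ps z; exists (cprj f y).
apply: linear_inj => c; have [y <-] := cprj_surj c; rewrite hE => /fp yE.
exact/cprjP.
Qed.

Record torsion_pair (T F : fgmod A -> Prop) : Prop := TorsionPair {
  tp_quot : forall X Y (p : {linear X -> Y}), surjective p -> T X -> T Y;
  tp_sub : forall X Y (i : {linear X -> Y}), injective i -> F Y -> F X;
  tp_hom : forall X Y (f : {linear X -> Y}), T X -> F Y -> forall x, f x = 0;
  tp_dec : forall M, exists L N (i : {linear L -> M}) (p : {linear M -> N}),
    [/\ short_exact i p, T L & F N] }.

Section TorsionPairTheory.
Variables (T F : fgmod A -> Prop).
Hypothesis tp : torsion_pair T F.

Lemma tp_isoT X Y : iso X Y -> T X -> T Y.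
Proof. by move=> [f /bij_surj fs]; apply: (tp_quot tp fs). Qed.

Lemma tp_isoF X Y : iso X Y -> F X -> F Y.
Proof. by move=> /iso_sym[f /bij_inj fi]; apply: (tp_sub tp fi). Qed.

Lemma tp_zero X : T X -> F X -> is_zero X.
Proof.
move=> TX FX x; have [f fE] := id_exists X.
by rewrite -[x]fE; apply: (tp_hom tp).
Qed.

Lemma tp_T X : (forall Y (f : {linear X -> Y}), F Y -> forall x,
  f x = 0) -> T X.
Proof.
move=> h; have [L [N [i [p [[ii ip ps] TL FN]]]]] := tp_dec tp X.
apply: (tp_quot tp (p := i)) => // x; apply/ip; exact: h.
Qed.

Lemma tp_F Y : (forall X (f : {linear X -> Y}), T X -> forall x,
  f x = 0) -> F Y.
Proof.
move=> h; have [L [N [i [p [[ii ip ps] TL FN]]]]] := tp_dec tp Y.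
apply: (tp_sub tp (i := p)) => //; apply: linear_inj => y /ip[x <-]; exact: h.
Qed.

Lemma tp_T0 X : is_zero X -> T X.
Proof. by move=> X0; apply: tp_T => Y f _ x; rewrite (X0 x) raddf0. Qed.

Lemma tp_F0 X : is_zero X -> F X.
Proof. by move=> X0; apply: tp_F => Y f _ x; apply: X0. Qed.

Lemma tp_extT X Y Z (f : {linear X -> Y}) (g : {linear Y -> Z}) :
  short_exact f g -> T X -> T Z -> T Y.
Proof.
move=> [fi fg gs] TX TZ; apply: tp_T => W p FW.
have [pf pfE] := comp_exists p f.
have [|q qE] := @factor_surj _ _ _ _ _ g p gs.
  by move=> y /fg[x <-]; rewrite -pfE; apply: (tp_hom tp).
by move=> y; rewrite -qE; apply: (tp_hom tp).
Qed.

Lemma tp_extF X Y Z (f : {linear X -> Y}) (g : {linear Y -> Z}) :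
  short_exact f g -> F X -> F Z -> F Y.
Proof.
move=> [fi fg gs] FX FZ; apply: tp_F => W p TW.
have [gp gpE] := comp_exists g p.
have [|q qE] := @lift_inj _ _ _ _ _ f p fi.
  by move=> w; apply/fg; rewrite -gpE; apply: (tp_hom tp).
by move=> y; rewrite -qE (_ : q y = 0) ?raddf0 //; apply: (tp_hom tp).
Qed.

Lemma tp_mapF X Y (f : {linear X -> Y}) : F (kerm f) -> F Y -> F X.
Proof.
move=> FK FY; have [I [p [i [ps ii ip]]]] := image_exists f.
apply: (tp_extF (f := kinc f) (g := p)) => //; last exact: (tp_sub tp ii FY).
split=> //; first exact: kinc_inj.
by move=> x; rewrite -kincP -ip; split=> [->|/(inj_eq0 ii)//]; apply: raddf0.
Qed.

Lemma tp_mapT X Y (f : {linear X -> Y}) : T X -> T (cokm f) -> T Y.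
Proof.
move=> TX TC; have [I [p [i [ps ii ip]]]] := image_exists f.
apply: (tp_extT (f := i) (g := cprj f)) => //; last exact: (tp_quot tp ps TX).
split=> //; last exact: cprj_surj.
move=> y; rewrite cprjP; split=> [[x <-]|[z <-]]; first by exists (p x).
by have [x <-] := ps z; exists x; rewrite ip.
Qed.
End TorsionPairTheory.

(* A nonzero object of [T1 /\ F2] of minimal dimension is a brick. *)
Lemma torsion_sub_of_bricks (T1 F1 T2 F2 : fgmod A -> Prop) :
  torsion_pair T1 F1 -> torsion_pair T2 F2 ->
  (forall B, brick B -> T1 B -> T2 B) -> forall X, T1 X -> T2 X.
Proof.
move=> tp1 tp2 h X TX; have [L [N [i [p [[ii ip ps] TL FN]]]]] := tp_dec tp2 X.
have [N0|nN] := pselect (is_zero N).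
  by apply: (tp_quot tp2 (p := i)) => // x; apply/ip/N0.
have [|Y [[TY FY nY] Ymin]] := @min_measure (@mdim _ A) (fun Y => [/\ T1 Y,
  F2 Y & ~ is_zero Y]).
  by exists N; split=> //; apply: (tp_quot tp1 ps).
case: (nY); apply: (tp_zero tp2) => //; apply: h => //; split=> // f [y fy].
(* The image of a nonzero endomorphism is a quotient and a subobject of [Y], so it stays in both
   classes and minimality makes it all of [Y]. *)
have [I [a [j [sa ji aj]]]] := image_exists f.
have YI : (mdim Y <= mdim I)%N.
  apply: Ymin; split; first exact: (tp_quot tp1 sa).
    exact: (tp_sub tp2 ji).
  by move=> I0; apply: fy; rewrite -aj (I0 (a y)) raddf0.
have js := inj_dim_surj ji YI.
have fs : surjective f.
  by move=> z; have [w <-] := js z; have [x <-] := sa w; exists x; rewrite aj.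
by apply: bij_injsurj => //; apply: (surj_dim_inj fs).
Qed.

(** * Torsion pairs defined by a functional *)

Section Numeric.
Variables (V : realDomainType) (h : fgmod A -> V).
Hypothesis hA : ses_additive h.

(* Ttors, Tbar, Ftors and Fbar for functionals with values in [int] or [R]. *)
Definition nT X := forall N (p : {linear X -> N}), surjective p ->
  ~ is_zero N -> 0 < h N.
Definition nTb X := forall N (p : {linear X -> N}), surjective p -> 0 <= h N.
Definition nF X := forall L (i : {linear L -> X}), injective i ->
  ~ is_zero L -> h L < 0.
Definition nFb X := forall L (i : {linear L -> X}), injective i -> h L <= 0.

Let h0 := additive_zero hA.

Lemma surj_comp_exists X Y Z (f : {linear X -> Y}) (g : {linear Y -> Z}) :
  surjective f -> surjective g ->
  exists2 u : {linear X -> Z}, surjective u & forall x, u x = g (f x).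
Proof.
move=> fs gs; have [u uE] := comp_exists g f; exists u => // z.
by have [y <-] := gs z; have [x <-] := fs y; exists x.
Qed.

Lemma inj_comp_exists X Y Z (f : {linear X -> Y}) (g : {linear Y -> Z}) :
  injective f -> injective g ->
  exists2 u : {linear X -> Z}, injective u & forall x, u x = g (f x).
Proof.
move=> fi gi; have [u uE] := comp_exists g f; exists u => // x y.
by rewrite !uE => /gi/fi.
Qed.

Lemma nT_quot X Y (p : {linear X -> Y}) : surjective p -> nT X -> nT Y.
Proof. by move=> ps TX N q qs; have [u us _] := surj_comp_exists ps qs;
  apply: TX us. Qed.
Lemma nTb_quot X Y (p : {linear X -> Y}) : surjective p -> nTb X -> nTb Y.
Proof. by move=> ps TX N q qs; have [u us _] := surj_comp_exists ps qs;
  apply: TX us. Qed.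
Lemma nF_sub X Y (p : {linear X -> Y}) : injective p -> nF Y -> nF X.
Proof. by move=> ps TX N q qs; have [u us _] := inj_comp_exists qs ps;
  apply: TX us. Qed.
Lemma nFb_sub X Y (p : {linear X -> Y}) : injective p -> nFb Y -> nFb X.
Proof. by move=> ps TX N q qs; have [u us _] := inj_comp_exists qs ps;
  apply: TX us. Qed.

Lemma nT_nTb X : nT X -> nTb X.
Proof.
move=> TX N p ps; have [N0|nN] := pselect (is_zero N); first by rewrite h0.
exact/ltW/(TX N p).
Qed.

Lemma nF_nFb X : nF X -> nFb X.
Proof.
move=> TX N p ps; have [N0|nN] := pselect (is_zero N); first by rewrite h0.
exact/ltW/(TX N p).
Qed.

Lemma nTb_ext X Y Z (f : {linear X -> Y}) (g : {linear Y -> Z}) :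
  short_exact f g -> nTb X -> nTb Z -> nTb Y.
Proof.
move=> fg TX TZ N p ps.
have [I [C [a [i [c [b [sa sb /hA ->]]]]]]] := ses_quotient fg ps.
by rewrite addr_ge0 //; [apply: TX sa|apply: TZ sb].
Qed.

Lemma nT_ext X Y Z (f : {linear X -> Y}) (g : {linear Y -> Z}) :
  short_exact f g -> nT X -> nT Z -> nT Y.
Proof.
move=> fg TX TZ N p ps nN.
have [I [C [a [i [c [b [sa sb ic]]]]]]] := ses_quotient fg ps.
have hI : 0 <= h I by exact: (nT_nTb TX sa).
have hC : 0 <= h C by exact: (nT_nTb TZ sb).
rewrite (hA ic); have [I0|nI] := pselect (is_zero I); last first.
  by apply: ltr_wpDr => //; apply: TX sa nI.
have [C0|nC] := pselect (is_zero C); last first.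
  by apply: ltr_wpDl => //; apply: TZ sb nC.
case: nN => n; have [_ /(_ n)[+ _] _] := ic.
by rewrite (C0 (c n)) => /(_ erefl)[x <-]; rewrite (I0 x) raddf0.
Qed.

Lemma T_Fb_hom X Y (f : {linear X -> Y}) : nT X -> nFb Y -> forall x, f x = 0.
Proof.
move=> TX FY; apply: zero_mapP => -[x fx].
have [I [a [i [sa ii ai]]]] := image_exists f.
have := FY _ _ ii; rewrite leNgt (TX _ _ sa) // => I0.
by apply: fx; rewrite -ai (I0 (a x)) raddf0.
Qed.

Lemma Tb_F_hom X Y (f : {linear X -> Y}) : nTb X -> nF Y -> forall x, f x = 0.
Proof.
move=> TX FY; apply: zero_mapP => -[x fx].
have [I [a [i [sa ii ai]]]] := image_exists f.
have := TX _ _ sa; rewrite leNgt (FY _ _ ii) // => I0.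
by apply: fx; rewrite -ai (I0 (a x)) raddf0.
Qed.

(** Take a subobject in [T] of largest dimension. If the quotient were not in [F], a nonzero
    subobject of it in [T] would pull back to a larger extension in [T]. *)
Lemma dec_exists (T F : fgmod A -> Prop) :
  (forall X, is_zero X -> T X) ->
  (forall X Y Z (f : {linear X -> Y}) (g : {linear Y -> Z}),
    short_exact f g -> T X -> T Z -> T Y) ->
  (forall N, ~ F N -> exists L (i : {linear L -> N}),
     [/\ injective i, T L & ~ is_zero L]) ->
  forall M, exists L N (i : {linear L -> M}) (p : {linear M -> N}),
    [/\ short_exact i p, T L & F N].
Proof.
move=> T0 Te NF M.
have [||L [[i [ii TL]] Lmax]] := @max_measure (@mdim _ A)
    (fun L => exists i : {linear L -> M}, injective i /\ T L) (mdim M).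
- have [f fE] := id_exists M; exists (kerm f), (kinc f).
  split; first exact: kinc_inj.
  by apply/T0/kerm_zero => x y; rewrite !fE.
- by move=> L [i [/mdim_inj -> _]]; rewrite leq_addr.
exists L, (cokm i), i, (cprj i); split=> //; first exact: ses_coker.
apply: contrapT => /NF[L1 [j [ji TL1 nL1]]].
have [D [a [b [q [bq _ _ ai _]]]]] := ses_pullback j (ses_coker ii).
suff : (mdim D <= mdim L)%N.
  by rewrite (mdim_exact bq); move: (mdim_gt0 nL1); lia.
by apply: Lmax; exists a; split; [apply: ai|apply: Te bq _ _].
Qed.

Lemma torsion_pair_T_Fb : torsion_pair nT nFb.
Proof.
split; [exact: nT_quot|exact: nFb_sub|exact: T_Fb_hom|].
apply: dec_exists; first by move=> X X0 N p ps nN; case: nN => n;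
  have [x <-] := ps n; rewrite (X0 x) raddf0.
  exact: nT_ext.
move=> N nFN.
(* A smallest subobject of positive weight lies in [nT]: the kernel of a nonzero quotient is
   smaller, so its weight is at most 0 and the quotient keeps at least the weight of [L]. *)
have [|L [[i [ii hL]] Lmin]] := @min_measure (@mdim _ A)
    (fun L => exists i : {linear L -> N}, injective i /\ 0 < h L).
  apply: contrapT => hn; apply: nFN => L i ii; rewrite leNgt; apply/negP => hL.
  by apply: hn; exists L, i.
exists L, i; split=> //; last by move=> L0; move: hL; rewrite h0 ?ltxx.
move=> C p ps nC; have hE := additive_surj hA ps.
have [j ji _] := inj_comp_exists (@kinc_inj _ _ _ _ p) ii.
suff : h (kerm p) <= 0 by move=> hk; apply: lt_le_trans hL _; rewrite hE gerDr.
rewrite leNgt; apply/negP => hk.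
have : (mdim L <= mdim (kerm p))%N by apply: Lmin; exists j.
by rewrite (mdim_surj ps); move: (mdim_gt0 nC); lia.
Qed.

Lemma torsion_pair_Tb_F : torsion_pair nTb nF.
Proof.
split; [exact: nTb_quot|exact: nF_sub|exact: Tb_F_hom|].
apply: dec_exists.
- move=> X X0 N p ps; rewrite h0 // => n.
  by have [x <-] := ps n; rewrite (X0 x) raddf0.
- exact: nTb_ext.
move=> N nFN.
(* The same argument with a smallest nonzero subobject of nonnegative weight. *)
have [|L [[i [ii nL hL]] Lmin]] := @min_measure (@mdim _ A)
    (fun L => exists i : {linear L -> N}, [/\ injective i, ~ is_zero L &
      0 <= h L]).
  apply: contrapT => hn; apply: nFN => L i ii nL; rewrite ltNge;
    apply/negP => hL.
  by apply: hn; exists L, i.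
exists L, i; split=> //.
move=> C p ps; have [C0|nC] := pselect (is_zero C); first by rewrite h0.
have hE := additive_surj hA ps.
have [j ji _] := inj_comp_exists (@kinc_inj _ _ _ _ p) ii.
suff : h (kerm p) <= 0 by move=> hk; apply: le_trans hL _; rewrite hE gerDr.
have [K0|nK] := pselect (is_zero (kerm p)); first by rewrite h0.
rewrite leNgt; apply/negP => hk.
have : (mdim L <= mdim (kerm p))%N by apply: Lmin; exists j; split=> //;
  apply: ltW.
by rewrite (mdim_surj ps); move: (mdim_gt0 nC); lia.
Qed.
End Numeric.
End TorsionPairs.

(** * TF equivalence of a brick finite algebra *)

Section TFEquivalence.
Variables (R : realType) (k : fieldType) (A : falgType k).
Implicit Types (X Y Z M N L E Q I K C D W : fgmod A) (theta eta : K0dual R A).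

Lemma K0dual_additive theta : ses_additive theta.
Proof. by move=> X Y Z f g; apply: K0_additive. Qed.

Lemma TtorsP theta X : Ttors theta X <-> nT theta X.
Proof.
split=> [h N p ps|h [N p ps]]; last exact: h ps.
exact: (h (FactObj ps)).
Qed.
Lemma TbarP theta X : Tbar theta X <-> nTb theta X.
Proof.
split=> [h N p ps|h [N p ps]]; last exact: h ps.
exact: (h (FactObj ps)).
Qed.
Lemma FtorsP theta X : Ftors theta X <-> nF theta X.
Proof.
split=> [h N p ps|h [N p ps]]; last exact: h ps.
exact: (h (SubObj ps)).
Qed.
Lemma FbarP theta X : Fbar theta X <-> nFb theta X.
Proof.
split=> [h N p ps|h [N p ps]]; last exact: h ps.
exact: (h (SubObj ps)).
Qed.

Lemma torsion_pair_ext (T F T' F' : fgmod A -> Prop) :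
  (forall X, T X <-> T' X) -> (forall X, F X <-> F' X) ->
  torsion_pair T F -> torsion_pair T' F'.
Proof.
move=> TT FF; have -> : T' = T by apply/funext => X; apply/propext; rewrite TT.
by have -> : F' = F by apply/funext => X; apply/propext; rewrite FF.
Qed.

Lemma tp_Ttors theta : torsion_pair (Ttors theta) (Fbar theta).
Proof.
apply: torsion_pair_ext (torsion_pair_T_Fb (K0dual_additive theta)) => X.
  by rewrite TtorsP.
by rewrite FbarP.
Qed.

Lemma tp_Tbar theta : torsion_pair (Tbar theta) (Ftors theta).
Proof.
apply: torsion_pair_ext (torsion_pair_Tb_F (K0dual_additive theta)) => X.
  by rewrite TbarP.
by rewrite FtorsP.
Qed.

Lemma largest_torsion (T F : fgmod A -> Prop) M L N (i : {linear L -> M})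
    (p : {linear M -> N}) (ii : injective i) :
  torsion_pair T F -> exact_at i p -> T L -> F N -> largest_sub T (SubObj ii).
Proof.
move=> tp ip TL FN; split=> // L' TL' x; apply/ip.
have [q qE] := comp_exists p (sub_incl L').
by rewrite -qE; apply: (tp_hom tp).
Qed.

Lemma Ttors_Tbar theta X : Ttors theta X -> Tbar theta X.
Proof. by rewrite TtorsP TbarP; apply/nT_nTb/K0dual_additive. Qed.

Lemma Ftors_Fbar theta X : Ftors theta X -> Fbar theta X.
Proof. by rewrite FtorsP FbarP; apply/nF_nFb/K0dual_additive. Qed.

Lemma TF_MTF M theta eta : TF_equiv theta eta -> MTF_equiv M theta eta.
Proof.
move=> TF.
have eT X : Ttors theta X <-> Ttors eta X by have [] := TF X.
have eTb X : Tbar theta X <-> Tbar eta X by have [] := TF X.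
have [L [N [i [p [[ii ip ps] TL FN]]]]] := tp_dec (tp_Ttors theta) M.
have [L' [N' [i' [p' [[ii' ip' ps'] TL' FN']]]]] := tp_dec (tp_Tbar theta) M.
have lL := largest_torsion ii (tp_Ttors theta) ip TL FN.
have lL' := largest_torsion ii' (tp_Tbar theta) ip' TL' FN'.
have [f fE] : exists f : {linear L -> L'}, forall x, i' (f x) = i x.
  apply: lift_inj => // x; apply/ip'; have [u uE] := comp_exists p' i.
  by rewrite -uE; apply: (tp_hom (tp_Tbar theta)) => //; apply: Ttors_Tbar.
have fi : injective f by move=> x y e; apply: (ii); rewrite -!fE e.
exists (SubObj ii), (SubObj ii'), (cokm f); split.
- by split=> //; split=> [|S TS]; [apply/eT|apply: (proj2 lL); apply/eT].
- by split=> //; split=> [|S TS]; [apply/eTb|apply: (proj2 lL'); apply/eTb].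
- by exists f, (cprj f); split=> //; apply: ses_coker.
(* The support depends on [theta] only through the subcategory [Wss theta]. *)
suff -> : supp theta = supp eta by [].
rewrite /supp; suff -> : Wss theta = Wss eta by [].
apply/funext => X; apply/propext; rewrite /Wss.
by have [-> _ _ ->] := TF X.
Qed.

(** Here [L] is both the smaller and the larger torsion part of [M], so the semistable part is zero
    and both supports are empty. *)
Lemma MTF_of_common_torsion M L N (i : {linear L -> M}) (p : {linear M -> N})
    theta eta : short_exact i p -> Ttors theta L -> Ftors theta N ->
  Ttors eta L -> Ftors eta N -> MTF_equiv M theta eta.
Proof.
move=> [ii ip ps] TL FN TL' FN'.
have [f fE] := id_exists L.
have fs : surjective f by move=> x; exists x.
have W0 : is_zero (cokm f) by apply/cokm_zero.
exists (SubObj ii), (SubObj ii), (cokm f); split.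
- by split; [apply: (largest_torsion ii (tp_Ttors theta) ip)
            |apply: (largest_torsion ii (tp_Ttors eta) ip)] => //;
              apply: Ftors_Fbar.
- by split; [apply: (largest_torsion ii (tp_Tbar theta) ip)
            |apply: (largest_torsion ii (tp_Tbar eta) ip)] => //;
              apply: Ttors_Tbar.
- exists f, (cprj f); split; first by move=> x /=; rewrite fE.
  by apply: ses_coker => x y; rewrite !fE.
have supp0 theta' S : ~ supp theta' (cokm f) S.
  case=> s1 [s2 h].
  have key Y s : comp_series (Wss theta') Y s -> is_zero Y -> s = [::].
    case=> // X Y' S' u v t _ [_ _ vs] [_ nS _] _ X0; case: nS => z.
    by have [x <-] := vs z; rewrite (X0 x) raddf0.
  by move: (key _ _ h W0); case: s1 {h}.
by move=> S; split=> /supp0.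
Qed.

(** Torsion classes are compared by their bricks, and each torsion-free class is the right
    orthogonal of its torsion class. *)
Lemma TF_of_bricks theta eta :
  (forall B, brick B -> Ttors theta B <-> Ttors eta B) ->
  (forall B, brick B -> Tbar theta B <-> Tbar eta B) -> TF_equiv theta eta.
Proof.
move=> h hb.
have eT X : Ttors theta X <-> Ttors eta X.
  by split; apply: (torsion_sub_of_bricks (tp_Ttors _) (tp_Ttors _)) => B /h[].
have eTb X : Tbar theta X <-> Tbar eta X.
  by split; apply: (torsion_sub_of_bricks (tp_Tbar _) (tp_Tbar _)) => B /hb[].
have torsion_free (T F T' F' : fgmod A -> Prop) X : torsion_pair T F ->
    torsion_pair T' F' -> (forall X, T X <-> T' X) -> F X -> F' X.
  move=> tp tp' TT FX; apply: (tp_F tp') => Y f /TT TY; exact: (tp_hom tp).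
move=> X; split=> //; split.
- exact: torsion_free (tp_Tbar _) (tp_Tbar _) _.
- by apply: torsion_free (tp_Tbar _) (tp_Tbar _) _ => Y; split=> /eTb.
- exact: torsion_free (tp_Ttors _) (tp_Ttors _) _.
- by apply: torsion_free (tp_Ttors _) (tp_Ttors _) _ => Y; split=> /eT.
Qed.

(** As a subobject of [M] in [T], the summand [B] lies inside [L]; the retraction restricted to [L]
    is then onto [B], so [B] inherits [T'] as a quotient of [L]. *)
Lemma largest_sub_summand (T T' F' : fgmod A -> Prop) M (L : subobj M) (B :
  fgmod A)
    (j : {linear B -> M}) (q : {linear M -> B}) :
  torsion_pair T' F' -> largest_sub T L -> T' L -> (forall b, q (j b) = b) ->
  T B -> T' B.
Proof.
move=> tp' [TL Lmax] TL' qj TB.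
have ji : injective j by move=> x y e; rewrite -[x]qj e qj.
have [u uE] := comp_exists q (sub_incl L).
apply: (tp_quot tp' (p := u)) TL' => b.
have [x /= xE] := Lmax (SubObj ji) TB b.
by exists x; rewrite uE xE qj.
Qed.

Lemma regular_fg : finitely_generated (A^c)^o.
Proof.
exists 1%N, (fun=> 1) => x; exists (fun=> x).
by rewrite big_ord1; exact: (esym (mulr1 (x : A^c))).
Qed.
Definition regular_module : fgmod A := FGMod regular_fg.

Lemma common_summand_module n (B : 'I_n -> fgmod A) :
  exists M, forall i, exists (j : {linear B i -> M}) (q : {linear M -> B i}),
    forall b, q (j b) = b.
Proof.
elim: n B => [|n IHn] B.
  (* Any module serves the empty family. *)
  by exists regular_module => -[].
have [M MP] := IHn (fun i => B (lift ord0 i)).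
exists (dsum (B ord0) M) => i; case: (unliftP ord0 i) => [i' ->|->].
  have [j [q qj]] := MP i'.
  have [j' jE] : exists j' : {linear B (lift ord0 i') -> dsum (B ord0) M},
    forall b, j' b = (0, j b).
    apply: linear_exists => a x y; rewrite linearP.
    by congr (_, _); rewrite /= scaler0 addr0.
  have [q' qE] : exists q' : {linear dsum (B ord0) M -> B (lift ord0 i')},
    forall b, q' b = q b.2.
    by apply: linear_exists => a x y; rewrite linearP.
  by exists j', q' => b; rewrite qE jE qj.
have [j' jE] : exists j' : {linear B ord0 -> dsum (B ord0) M}, forall b,
  j' b = (b, 0).
  apply: linear_exists => a x y; rewrite /=.
  by congr (_, _); rewrite /= scaler0 addr0.
have [q' qE] : exists q' : {linear dsum (B ord0) M -> B ord0}, forall b,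
  q' b = b.1.
  by apply: linear_exists.
by exists j', q' => b; rewrite qE jE.
Qed.

Lemma brick_finite_MTF : brick_finite A ->
  exists M, forall theta eta, MTF_equiv M theta eta <-> TF_equiv theta eta.
Proof.
move=> [n [B BP]]; have [M MP] := common_summand_module B;
  exists M => theta eta.
split; last exact: TF_MTF.
move=> [L [Lb [W [[tL tL'] [tLb tLb'] _ _]]]].
have summand (T F T' F' : fgmod A -> Prop) (L' : subobj M) S :
    torsion_pair T F -> torsion_pair T' F' -> largest_sub T L' -> T' L' ->
    brick S -> T S -> T' S.
  move=> tp tp' lL' TL' /BP[i Si] /(tp_isoT tp Si) TB.
  have [j [q qj]] := MP i.
  apply: (tp_isoT tp' (iso_sym Si)).
  exact: largest_sub_summand tp' lL' TL' qj TB.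
apply: TF_of_bricks => S bS; split.
- exact: (summand _ _ _ _ L S (tp_Ttors theta) (tp_Ttors eta) tL (proj1 tL')).
- exact: (summand _ _ _ _ L S (tp_Ttors eta) (tp_Ttors theta) tL' (proj1 tL)).
- exact: (summand _ _ _ _ Lb S (tp_Tbar theta) (tp_Tbar eta) tLb (proj1 tLb')).
- exact: (summand _ _ _ _ Lb S (tp_Tbar eta) (tp_Tbar theta) tLb' (proj1 tLb)).
Qed.
End TFEquivalence.

(** * Simple objects of the tilted heart *)

Section Heart.
Variables (k : fieldType) (A : falgType k).
Implicit Types X Y Z M N L E Q I K C D W B V : fgmod A.
Variables (T F : fgmod A -> Prop).
Hypothesis tp : torsion_pair T F.

(* The simple objects of the heart [F[1] * T] lie in [T] or in [F[1]]. A map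
   between objects of [T] is a monomorphism of the heart iff its kernel is in
   [F]; a map between objects of [F] is an epimorphism of the heart, after a
   shift, iff its cokernel is in [T]. *)
Definition Tsimple X := [/\ T X, ~ is_zero X &
  forall Z (f : {linear Z -> X}), T Z -> F (kerm f) -> nonzero_map f ->
    bijective f].

Definition Fsimple Y := [/\ F Y, ~ is_zero Y &
  forall Z (f : {linear Y -> Z}), F Z -> T (cokm f) -> nonzero_map f ->
    bijective f].

(** Dividing by the torsion part of the kernel gives the image factorization in the heart: [q] is an
    epimorphism there and [f'] a monomorphism. *)
Lemma reduce_T Z X (f : {linear Z -> X}) : T Z ->
  exists Z' (q : {linear Z -> Z'}) (f' : {linear Z' -> X}),
    [/\ surjective q, forall z, f' (q z) = f z, T Z', F (kerm f') & T (kerm q)].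
Proof.
move=> TZ; have [L [N [i [p [[ii ip ps] TL FN]]]]] := tp_dec tp (kerm f).
have [u ui uE] := inj_comp_exists ii (@kinc_inj _ _ _ _ f).
pose q := cprj u.
have [|f' f'E] := @factor_surj _ _ _ _ _ q f (@cprj_surj _ _ _ _ u).
  by move=> z /cprjP[l <-]; rewrite uE kincE.
exists (cokm u), q, f'; split=> //; first exact: cprj_surj.
- exact: (tp_quot tp (@cprj_surj _ _ _ _ u)).
- have [g gE] := comp_exists q (kinc f).
  have [|r rE] := @lift_inj _ _ _ _ _ (kinc f') g (@kinc_inj _ _ _ _ f').
    by move=> z; apply/kincP; rewrite gE f'E kincE.
  have rs : surjective r.
    move=> y; have [z zE] := @cprj_surj _ _ _ _ u (kinc f' y).
    have : f z = 0 by rewrite -f'E -[q z]/(cprj u z) zE kincE.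
    move=> /kincP[x xE]; exists x; apply: (@kinc_inj _ _ _ _ f').
    by rewrite rE gE xE.
  have r0 z : r z = 0 <-> exists l, i l = z.
    split=> [rz|[l <-]].
      have : q (kinc f z) = 0 by rewrite -gE -rE rz raddf0.
      move=> /cprjP[l lE]; exists l; apply: (@kinc_inj _ _ _ _ f).
      by rewrite -uE.
    apply: (@kinc_inj _ _ _ _ f').
    by rewrite rE gE -uE raddf0 /q cprjE.
  have [|h hE] := @factor_surj _ _ _ _ _ r p rs; first by move=> z /r0/ip.
  apply: (tp_sub tp (i := h)) FN; apply: linear_inj => y.
  by have [z <-] := rs y; rewrite hE => /ip/r0.
- apply: (tp_isoT tp (X := L)) => //; apply: (kerm_iso ui).
  by move=> z; apply: cprjP.
Qed.

(** The dual factorization: [X'] is the preimage in [X] of the torsion part of the cokernel. *)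
Lemma reduce_F Y X (f : {linear Y -> X}) : F X ->
  exists X' (i : {linear X' -> X}) (f' : {linear Y -> X'}),
    [/\ injective i, forall y, i (f' y) = f y, F X', T (cokm f') & F (cokm i)].
Proof.
move=> FX; have [L [N [a [p [[ai ap ps] TL FN]]]]] := tp_dec tp (cokm f).
have [v vs vE] := surj_comp_exists (@cprj_surj _ _ _ _ f) ps.
pose i := kinc v.
have [|f' f'E] := @lift_inj _ _ _ _ _ i f (@kinc_inj _ _ _ _ v).
  by move=> y; apply/kincP; rewrite vE cprjE raddf0.
exists (kerm v), i, f'; split=> //; first exact: kinc_inj.
- exact: (tp_sub tp (@kinc_inj _ _ _ _ v)).
- have [g gE] := comp_exists (cprj f) i.
  have [|r rE] := @lift_inj _ _ _ _ _ a g ai.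
    by move=> x; apply/ap; rewrite gE -vE kincE.
  have rs : surjective r.
    move=> l; have [x xE] := @cprj_surj _ _ _ _ f (a l).
    have /kincP[x' x'E] : v x = 0 by rewrite vE xE; apply/ap; exists l.
    by exists x'; apply: ai; rewrite rE gE -xE -x'E.
  have [|h hE] := @factor_surj _ _ _ _ _ r (cprj f') rs.
    move=> x rx; apply/cprjP.
    have /cprjP[y yE] : cprj f (i x) = 0 by rewrite -gE -rE rx raddf0.
    by exists y; apply: (@kinc_inj _ _ _ _ v); rewrite -yE -f'E.
  apply: (tp_quot tp (p := h)) TL => c.
  by have [x <-] := cprj_surj c; exists (r x); rewrite hE.
- apply: (tp_isoF tp (X := N)) => //; apply: iso_sym; apply: (cokm_iso vs).
  by move=> z; apply: kincP.
Qed.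

(** In the image factorization the monomorphism into the simple [X] is invertible, so [f] is the
    quotient map [q] up to isomorphism. *)
Lemma Tsimple_strong X Z (f : {linear Z -> X}) :
  Tsimple X -> T Z -> nonzero_map f -> surjective f /\ T (kerm f).
Proof.
move=> [TX nX sX] TZ [x fx].
have [Z' [q [f' [qs f'E TZ' Fk Tk]]]] := reduce_T f TZ.
have fb : bijective f' by apply: sX => //; exists (q x); rewrite f'E.
split.
  move=> y; have [z <-] := bij_surj fb y; have [w <-] := qs z.
  by exists w; rewrite f'E.
apply: (tp_isoT tp _ Tk); apply: kerm_iso; first exact: kinc_inj.
move=> z; rewrite -kincP -f'E; split=> [/(inj_eq0 (bij_inj fb))//|->].
exact: raddf0.
Qed.

Lemma Fsimple_strong Y Z (f : {linear Y -> Z}) :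
  Fsimple Y -> F Z -> nonzero_map f -> injective f /\ F (cokm f).
Proof.
move=> [FY nY sY] FZ [x fx].
have [Z' [i [f' [ii f'E FZ' Tk Fk]]]] := reduce_F f FZ.
have fb : bijective f'.
  by apply: sY => //; exists x => f'x; apply: fx; rewrite -f'E f'x raddf0.
split; first by move=> y z; rewrite -!f'E => /ii/(bij_inj fb).
apply: (tp_isoF tp _ Fk); apply: iso_sym; apply: cokm_iso;
  first exact: cprj_surj.
move=> z; rewrite cprjP; split=> [[y <-]|[y <-]]; last by exists (f' y).
by have [w <-] := bij_surj fb y; exists w.
Qed.

(** * Finite length of the heart from a positive weight *)

Section Weight.
Variable w : fgmod A -> int.
Hypothesis wA : ses_additive w.
Hypothesis wT : forall X, T X -> ~ is_zero X -> 0 < w X.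
Hypothesis wF : forall X, F X -> ~ is_zero X -> w X < 0.

Lemma weight_T X : T X -> 0 <= w X.
Proof.
by move=> TX; have [/(additive_zero wA) ->|/wT/ltW->] := pselect (is_zero X).
Qed.
Lemma weight_F X : F X -> w X <= 0.
Proof.
by move=> TX; have [/(additive_zero wA) ->|/wF/ltW->] := pselect (is_zero X).
Qed.
Lemma weight_T0 X : T X -> w X <= 0 -> is_zero X.
Proof. by move=> TX wX; apply: contrapT => /wT => /(_ TX); lia. Qed.
Lemma weight_F0 X : F X -> 0 <= w X -> is_zero X.
Proof. by move=> TX wX; apply: contrapT => /wF => /(_ TX); lia. Qed.

(** Since [w (kerm f) <= 0 <= w (cokm f)], the assumed inequality makes both weights vanish. *)
Lemma weight_bij X Y (f : {linear X -> Y}) :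
  F (kerm f) -> T (cokm f) -> w (cokm f) <= w (kerm f) -> bijective f.
Proof.
move=> FK TC h; have := weight_F FK; have := weight_T TC => h1 h2.
apply: bij_injsurj; first by apply/kerm_zero/weight_F0 => //; lia.
by apply/cokm_zero/weight_T0 => //; lia.
Qed.

(** Induction on the weight. A monomorphism [f : Z -> X] of the heart has a quotient composed of
    [cokm f] and [(kerm f)[1]]; if [f] is proper and nonzero, [Z], [cokm f] and [kerm f] all have
    smaller weight than [X], and [h] adds up with the right signs. *)
Lemma heart_generation (h : fgmod A -> int) : ses_additive h ->
  (forall X, Tsimple X -> 0 <= h X) -> (forall Y, Fsimple Y -> h Y <= 0) ->
  (forall X, T X -> 0 <= h X) /\ (forall Y, F Y -> h Y <= 0).
Proof.
move=> hA hT hF.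
suff key n : (forall X, T X -> (`|w X| < n)%N -> 0 <= h X) /\
             (forall Y, F Y -> (`|w Y| < n)%N -> h Y <= 0).
  split=> X HX; first exact: (proj1 (key _) X HX (ltnSn _)).
  exact: (proj2 (key _) X HX (ltnSn _)).
elim: n => [//|n [IHT IHF]]; split=> X HX wX.
  have [X0|nX] := pselect (is_zero X); first by rewrite (additive_zero hA).
  have [/hT//|nS] := pselect (Tsimple X).
  have [Z [f [TZ FK nf nb]]] : exists Z (f : {linear Z -> X}),
      [/\ T Z, F (kerm f), nonzero_map f & ~ bijective f].
    apply: contrapT => hn; apply: nS; split=> // Z f TZ FK nf.
    by apply: contrapT => nb; apply: hn; exists Z, f.
  have TC : T (cokm f) := tp_quot tp (@cprj_surj _ _ _ _ f) HX.
  have nZ : ~ is_zero Z by move=> Z0; case: nf => z; rewrite (Z0 z) raddf0.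
  have hE := additive_map hA f; have wE := additive_map wA f.
  have wZ := wT TZ nZ; have wC := weight_T TC; have wK := weight_F FK.
  have wl : w (kerm f) < w (cokm f).
    by rewrite ltNge; apply/negP => h1; apply: nb; apply: weight_bij.
  have := IHT _ TZ; have := IHT _ TC; have := IHF _ FK; lia.
have [X0|nX] := pselect (is_zero X); first by rewrite (additive_zero hA).
have [/hF//|nS] := pselect (Fsimple X).
have [Z [f [TZ FK nf nb]]] : exists Z (f : {linear X -> Z}),
    [/\ F Z, T (cokm f), nonzero_map f & ~ bijective f].
  apply: contrapT => hn; apply: nS; split=> // Z f TZ FK nf.
  by apply: contrapT => nb; apply: hn; exists Z, f.
have TC : F (kerm f) := tp_sub tp (@kinc_inj _ _ _ _ f) HX.
have nZ : ~ is_zero Z by move=> Z0; case: nf => z; rewrite (Z0 (f z)).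
have hE := additive_map hA f; have wE := additive_map wA f.
have wZ := wF TZ nZ; have wC := weight_F TC; have wK := weight_T FK.
have wl : w (kerm f) < w (cokm f).
  by rewrite ltNge; apply/negP => h1; apply: nb; apply: weight_bij.
have := IHF _ TZ; have := IHF _ TC; have := IHT _ FK; lia.
Qed.

(** A nonzero subobject of [Z] in the heart with least weight is simple; such subobjects lie in [T]
    again. *)
Lemma heart_socle Z : T Z -> ~ is_zero Z ->
  exists V (f : {linear V -> Z}), [/\ Tsimple V, F (kerm f) & nonzero_map f].
Proof.
move=> TZ nZ.
have [|V [[f [TV FK nf]] Vmin]] :=
  @min_measure _ A (fun V => `|w V|%N) (fun V =>
    exists f : {linear V -> Z}, [/\ T V, F (kerm f) & nonzero_map f]).
  have [f fE] := id_exists Z; exists Z, f; split=> //.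
    by apply: (tp_F0 tp); apply/kerm_zero => x y; rewrite !fE.
  by have [z nz] := not_zeroP nZ; exists z; rewrite fE.
exists V, f; split=> //; split=> //.
  by move=> V0; case: nf => z; rewrite (V0 z) raddf0.
move=> B g TB FKg [b gb].
have [fg fgE] := comp_exists f g.
(* The composite with [f] is again a monomorphism of the heart: its kernel is an extension of a part
   of [kerm f] by a part of [kerm g]. Minimality of [V] then rules out a proper [B]. *)
have : (`|w V| <= `|w B|)%N.
  apply: Vmin; exists fg; split=> //.
    have [gk gkE] := comp_exists g (kinc fg).
    have [|r rE] := @lift_inj _ _ _ _ _ (kinc f) gk (@kinc_inj _ _ _ _ f).
      by move=> z; apply/kincP; rewrite gkE -fgE kincE.
    apply: (tp_mapF tp (f := r)) => //.
    have [rk rkE] := comp_exists (kinc fg) (kinc r).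
    have [|u uE] := @lift_inj _ _ _ _ _ (kinc g) rk (@kinc_inj _ _ _ _ g).
      by move=> z; apply/kincP; rewrite rkE -gkE -rE kincE raddf0.
    apply: (tp_sub tp (i := u)) => // x y e.
    apply: (@kinc_inj _ _ _ _ r); apply: (@kinc_inj _ _ _ _ fg).
    by rewrite -!rkE -!uE e.
  apply: contrapT => /zero_mapP fg0.
  have [|r rE] := @lift_inj _ _ _ _ _ (kinc f) g (@kinc_inj _ _ _ _ f).
    by move=> z; apply/kincP; rewrite -fgE.
  by apply: gb; rewrite -rE (tp_hom tp r TB FK) raddf0.
move=> h; have TC : T (cokm g) := tp_quot tp (@cprj_surj _ _ _ _ g) TV.
apply: weight_bij => //.
have := additive_map wA g; have := weight_T TB; have := weight_T TV; lia.
Qed.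

(** Dual to the socle: quotients of [Y[1]] in the heart stay in [F[1]], so one of least weight is
    the shift of an [Fsimple] object. *)
Lemma heart_top_F Y : F Y -> ~ is_zero Y ->
  exists V (f : {linear Y -> V}), [/\ Fsimple V, T (cokm f) & nonzero_map f].
Proof.
move=> FY nY.
have [|V [[f [FV TC nf]] Vmin]] :=
  @min_measure _ A (fun V => `|w V|%N) (fun V =>
    exists f : {linear Y -> V}, [/\ F V, T (cokm f) & nonzero_map f]).
  have [f fE] := id_exists Y; exists Y, f; split=> //.
    by apply: (tp_T0 tp); apply/cokm_zero => x; exists x; rewrite !fE.
  by have [z nz] := not_zeroP nY; exists z; rewrite fE.
exists V, f; split=> //; split=> //.
  by move=> V0; case: nf => z; rewrite (V0 (f z)).
move=> B g FB TCg [b gb].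
have [gf gfE] := comp_exists g f.
have : (`|w V| <= `|w B|)%N.
  apply: Vmin; exists gf; split=> //.
    have [gk gkE] := comp_exists (cprj gf) g.
    have [|r rE] := @factor_surj _ _ _ _ _ (cprj f) gk (@cprj_surj _ _ _ _ f).
      by move=> z /cprjP[y <-]; rewrite gkE -gfE cprjE.
    apply: (tp_mapT tp (f := r)) => //.
    have [rk rkE] := comp_exists (cprj r) (cprj gf).
    have [|u uE] := @factor_surj _ _ _ _ _ (cprj g) rk (@cprj_surj _ _ _ _ g).
      by move=> z /cprjP[y <-]; rewrite rkE -gkE -rE cprjE.
    apply: (tp_quot tp (p := u)) TCg => z.
    have [y <-] := cprj_surj z; have [x <-] := cprj_surj y.
    by exists (cprj g x); rewrite uE rkE.
  apply: contrapT => /zero_mapP fg0.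
  have [|r rE] := @factor_surj _ _ _ _ _ (cprj f) g (@cprj_surj _ _ _ _ f).
    by move=> z /cprjP[y <-]; rewrite -gfE.
  by apply: gb; rewrite -rE (tp_hom tp r TC FB).
move=> h; have FC : F (kerm g) := tp_sub tp (@kinc_inj _ _ _ _ g) FV.
apply: weight_bij => //.
have := additive_map wA g; have := weight_F FB; have := weight_F FV; lia.
Qed.

(* A maximal proper subobject of [Z] in the heart [F[1] * T] is a map [f] from
   an object of [T] with kernel in [F]; the simple quotient is [cokm f] or
   [(kerm f)[1]]. *)
Lemma heart_top Z : T Z -> ~ is_zero Z ->
  (exists V (p : {linear Z -> V}), [/\ Tsimple V, surjective p & T (kerm p)]) \/
  (exists Y Z1 (i : {linear Y -> Z1}) (q : {linear Z1 -> Z}),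
     [/\ Fsimple Y, T Z1 & short_exact i q]).
Proof.
move=> TZ nZ.
have TC V (f : {linear V -> Z}) : T (cokm f) :=
  tp_quot tp (@cprj_surj _ _ _ _ f) TZ.
have [||V [[f [TV FK nf]] Vmax]] :=
  @max_measure _ A (fun V => `|w V|%N) (fun V =>
    exists f : {linear V -> Z}, [/\ T V, F (kerm f) & ~ bijective f]) `|w Z|%N.
(* The kernel of the identity serves as zero object. *)
- have [f fE] := id_exists Z; have [g gE] := zero_exists (kerm f) Z.
  have K0 : is_zero (kerm f) by apply/kerm_zero => x y; rewrite !fE.
  exists (kerm f), g; split=> //; first exact: (tp_T0 tp).
    by apply: (tp_sub tp (@kinc_inj _ _ _ _ g)); exact: (tp_F0 tp).
  move=> /bij_surj gs; apply: nZ => z; have [x <-] := gs z; exact: gE.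
- move=> V [f [TV FK _]]; have := additive_map wA f.
  have := weight_F FK; have := weight_T (TC _ f); have := weight_T TV; lia.
have wf := additive_map wA f.
have := weight_T TV; have := weight_F FK; have := weight_T (TC _ f) => hC hK hV.
have [C0|nC] := pselect (is_zero (cokm f)).
  have fs : surjective f by apply/cokm_zero.
  right; exists (kerm f), V, (kinc f), f; split=> //; last exact: ses_ker.
  split=> //.
    by move=> /kerm_zero fi; apply: nf; apply: bij_injsurj.
  move=> Y h FY Th [y hy].
  (* The pushout along [h] gives a subobject [q : D -> Z] of the heart between [V] and [Z];
     maximality of [V] forces [q] or [h] to be bijective, and [q] is not, since [Y] embeds in its
     kernel. *)
  have [D [a [b [q [c [[bi bq qs] qa cs _]]]]]] := ses_pushout h (ses_ker fs).
  have TD : T D by apply: (tp_mapT tp (f := a)) => //;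
    exact: (tp_quot tp cs Th).
  have FKq : F (kerm q) by apply: (tp_isoF tp _ FY); exact: (kerm_iso bi bq).
  have wD : w D = w Y + w Z by apply: (wA (f := b) (g := q)).
  have wV : w V = w (kerm f) + w Z := additive_surj wA fs.
  have wh := additive_map wA h.
  have FKh : F (kerm h) := tp_sub tp (@kinc_inj _ _ _ _ h) FK.
  have [qb|nqb] := pselect (bijective q).
    case: hy; apply: (inj_eq0 bi); apply: (inj_eq0 (bij_inj qb)).
    by apply/bq; exists (h y).
  have : (`|w D| <= `|w V|)%N by apply: Vmax; exists q.
  have := weight_T TD; have := weight_T TZ => h1 h2 h3.
  by apply: weight_bij => //; lia.
(* If [f] is not surjective, its image is still a proper subobject, and
   [w V = w (kerm f) + w I <= w I]; maximality of [V] leaves the kernel no weight, so it is zero. *)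
left; have [I [p [i [ps ii ip]]]] := image_exists f.
have TI : T I := tp_quot tp ps TV.
have wV : w V = w (kerm f) + w I.
  apply: (wA (f := kinc f) (g := p)); split=> //; first exact: kinc_inj.
  by move=> x; rewrite -kincP -ip; split=> [->|/(inj_eq0 ii)//]; apply: raddf0.
have : (`|w I| <= `|w V|)%N.
  apply: Vmax; exists i; split=> //; first by apply: (tp_F0 tp);
    apply/kerm_zero.
  move=> /bij_surj is_; apply/nC/cokm_zero => z; have [y <-] := is_ z.
  by have [x <-] := ps y; exists x; rewrite ip.
move=> hI; have := weight_T TI => wI.
have fi : injective f by apply/kerm_zero; apply: weight_F0 => //; lia.
exists (cokm f), (cprj f); split; last 2 first.
- exact: cprj_surj.
- by apply: (tp_isoT tp _ TV); apply: (kerm_iso fi) => z; apply: cprjP.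
split=> // B h TB FKh [b hb].
(* A subobject of [cokm f] pulls back to a subobject of [Z] of larger weight than [V], which must be
   all of [Z]. *)
have [D [a [b' [q [[b'i b'q qs] aq ab _ a0]]]]] :=
  ses_pullback h (ses_coker fi).
have TD : T D by apply: (tp_extT tp (f := b') (g := q)).
have FKa : F (kerm a).
  have [u uE] := comp_exists q (kinc a).
  have [|r rE] := @lift_inj _ _ _ _ _ (kinc h) u (@kinc_inj _ _ _ _ h).
    by move=> z; apply/kincP; rewrite uE -aq kincE raddf0.
  apply: (tp_sub tp (i := r)) => //; apply: linear_inj => x rx.
  apply: (@kinc_inj _ _ _ _ a); rewrite raddf0; apply: a0; first exact: kincE.
  by rewrite -uE -rE rx raddf0.
have wD : w D = w V + w B by apply: (wA (f := b') (g := q)).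
have wB : 0 < w B by apply: wT => // B0; apply: hb; rewrite (B0 b) raddf0.
have ab_ : bijective a.
  apply: contrapT => na; have : (`|w D| <= `|w V|)%N by apply: Vmax; exists a.
  by have := weight_T TD; lia.
apply: bij_injsurj.
  apply: linear_inj => x hx; have [d dE] := qs x.
  have /cprjP[v vE] : cprj f (a d) = 0 by rewrite aq dE.
  move: vE; rewrite -ab => /(bij_inj ab_) vE; rewrite -dE -vE.
  by apply/b'q; exists v.
move=> c; have [z <-] := cprj_surj c; have [d <-] := bij_surj ab_ z.
by exists (q d); rewrite aq.
Qed.
End Weight.
End Heart.

(** * Crossing a wall *)

Section Mutation.
Variables (k : fieldType) (A : falgType k).
Implicit Types X Y Z M N L E Q I K C D W B V : fgmod A.
Variables (T F : fgmod A -> Prop).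
Hypothesis tp : torsion_pair T F.
Variable w : fgmod A -> int.
Hypothesis wA : ses_additive w.
Hypothesis wT : forall X, T X -> ~ is_zero X -> 0 < w X.
Hypothesis wF : forall X, F X -> ~ is_zero X -> w X < 0.
Variable X0 : fgmod A.
Hypothesis sX0 : Tsimple T F X0.
Variable g : fgmod A -> int.
Hypothesis gA : ses_additive g.
Hypothesis gX0 : g X0 = 1.
Hypothesis gT : forall V, Tsimple T F V -> ~ iso V X0 -> g V = 0.
Hypothesis gF : forall V, Fsimple T F V -> g V = 0.

(* [g] is the multiplicity of [X0] in the heart, and [wall] is the point where
   the ray from [w] in the direction [- g] leaves the chamber of [(T, F)]. *)
Definition wall Z : int := w Z - w X0 * g Z.

Lemma wall_additive : ses_additive wall.
Proof.
by move=> X Y Z f h fh; rewrite /wall (wA fh) (gA fh) mulrDr opprD addrACA. Qed.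
Let eA := wall_additive.

Definition mut_T := nT wall.
Definition mut_F := nFb wall.
Let tp' : torsion_pair mut_T mut_F := torsion_pair_T_Fb eA.

Lemma wallX0 : wall X0 = 0.
Proof. by rewrite /wall gX0 mulr1 subrr. Qed.

Lemma wall_Tsimple V : Tsimple T F V -> ~ iso V X0 -> 0 < wall V.
Proof.
move=> sV nV; rewrite /wall gT // mulr0 subr0.
by case: sV => TV nzV _; apply: wT.
Qed.

Lemma wall_Fsimple V : Fsimple T F V -> wall V < 0.
Proof.
move=> sV; rewrite /wall gF // mulr0 subr0.
by case: sV => TV nzV _; apply: wF.
Qed.

(** It suffices to look at simple objects, where [wall] is zero on [X0] and agrees with [w] on the
    others. *)
Lemma wall_TF : (forall X, T X -> 0 <= wall X) /\ (forall Y, F Y ->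
  wall Y <= 0).
Proof.
apply: (heart_generation tp wA wT wF eA) => [V sV|V /wall_Fsimple/ltW//].
have [iV|nV] := pselect (iso V X0); last exact/ltW/wall_Tsimple.
by rewrite (additive_iso eA iV) wallX0.
Qed.

Lemma wall_T X : T X -> 0 <= wall X. Proof. exact: (proj1 wall_TF). Qed.
Lemma wall_F X : F X -> wall X <= 0. Proof. exact: (proj2 wall_TF). Qed.

(** A simple quotient of [Y[1]] in the heart comes from [F], hence is not [X0], and contributes
    strictly. *)
Lemma wall_F_lt Y : F Y -> ~ is_zero Y -> wall Y < 0.
Proof.
move=> FY nY; have [V [f [sV TC nf]]] := heart_top_F tp wA wT wF FY nY.
have := additive_map eA f; have := wall_Fsimple sV; have := wall_T TC.
have := wall_F (tp_sub tp (@kinc_inj _ _ _ _ f) FY); lia.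
Qed.

Lemma wall_mut_T Z : mut_T Z -> ~ is_zero Z -> 0 < wall Z.
Proof.
move=> TZ nZ; have [f fE] := id_exists Z.
by apply: (TZ _ f) => // z; exists z.
Qed.

Lemma wall_mut_F Z : mut_F Z -> wall Z <= 0.
Proof.
move=> FZ; have [f fE] := id_exists Z.
by apply: (FZ _ f) => // x y; rewrite !fE.
Qed.

Lemma F_mut_F Y : F Y -> mut_F Y.
Proof. by move=> FY L i ii; apply: wall_F; apply: (tp_sub tp ii). Qed.

Lemma mut_T_T Z : mut_T Z -> T Z.
Proof.
by move=> TZ; apply: (tp_T tp) => Y f /F_mut_F FY; apply: (tp_hom tp').
Qed.

Lemma wall_T_mut_F Z : T Z -> mut_F Z -> wall Z = 0.
Proof. by move=> /wall_T h1 /wall_mut_F h2; apply/eqP; rewrite eq_le h1 h2. Qed.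

(** A nonzero map from [mut_T] to the simple [X0] would be surjective and put [X0] in [mut_T], where
    [wall] is positive on nonzero objects. *)
Lemma mut_F_X0 : mut_F X0.
Proof.
apply: (tp_F tp') => Z f TZ; apply: zero_mapP => nf.
have [fs _] := Tsimple_strong tp sX0 (mut_T_T TZ) nf.
have := wall_mut_T (tp_quot tp' fs TZ); rewrite wallX0 ltxx => h.
by case: sX0 => _ /h.
Qed.

(** All composition factors of [Z] in the heart have wall value zero, and [X0] is the only such
    simple object. *)
Lemma wall_socle Z : T Z -> ~ is_zero Z -> wall Z = 0 ->
  exists f : {linear X0 -> Z}, F (kerm f) /\ nonzero_map f.
Proof.
move=> TZ nZ eZ; have [V [f [sV FK [v fv]]]] := heart_socle tp wA wT wF TZ nZ.
have TC := tp_quot tp (@cprj_surj _ _ _ _ f) TZ.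
have wV := additive_map eA f; have wC := wall_T TC; have wK := wall_F FK.
have [[u ub]|nV] := pselect (iso X0 V); last first.
  have := wall_Tsimple sV (fun h => nV (iso_sym h)); lia.
have [fu fuE] := comp_exists f u; exists fu; split; last first.
  by have [x xE] := bij_surj ub v; exists x; rewrite fuE xE.
have [uk ukE] := comp_exists u (kinc fu).
have [|r rE] := @lift_inj _ _ _ _ _ (kinc f) uk (@kinc_inj _ _ _ _ f).
  by move=> z; apply/kincP; rewrite ukE -fuE kincE.
apply: (tp_sub tp (i := r)) FK => x y e; apply: (@kinc_inj _ _ _ _ fu).
by apply: (bij_inj ub); rewrite -!ukE -!rE e.
Qed.

(** As for the socle; a simple quotient in [F[1]] would make [wall Z] positive. *)
Lemma wall_top Z : T Z -> ~ is_zero Z -> wall Z = 0 ->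
  exists p : {linear Z -> X0}, nonzero_map p.
Proof.
move=> TZ nZ eZ; case: (heart_top tp wA wT wF TZ nZ); last first.
  move=> [Y [Z1 [i [q [sY TZ1 iq]]]]].
  by have := wall_Fsimple sY; have := wall_T TZ1; have := eA iq; lia.
move=> [V [p [sV ps TK]]].
have [[u ub]|nV] := pselect (iso V X0); last first.
  by have := wall_Tsimple sV nV; have := wall_T TK; have :=
    additive_surj eA ps; lia.
have [up upE] := comp_exists u p; exists up; case: sV => _ /not_zeroP[v nv] _.
have [z zE] := ps v; exists z; rewrite upE zE => /(inj_eq0 (bij_inj ub));
  exact: nv.
Qed.

(** The [mut_F] quotient of [Z] lies in [T] and on the wall; were it nonzero, it would map
    nontrivially to [X0]. *)
Lemma T_mut_T Z : T Z -> (forall f : {linear Z -> X0}, ~ nonzero_map f) ->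
  mut_T Z.
Proof.
move=> TZ h; have [L [N [i [p [[ii ip ps] TL FN]]]]] := tp_dec tp' Z.
suff N0 : is_zero N by apply: (tp_quot tp' (p := i)) TL => z; apply/ip/N0.
apply: contrapT => nN; have TN := tp_quot tp ps TZ.
have [f [n fn]] := wall_top TN nN (wall_T_mut_F TN FN).
have [fp fpE] := comp_exists f p; apply: (h fp).
by have [z zE] := ps n; exists z; rewrite fpE zE.
Qed.

(** An object of [T] on the wall is an iterated extension of copies of [X0]: dividing out a copy
    from the socle stays in [T] and on the wall, with smaller [w]. *)
Lemma wall_eq0 (h : fgmod A -> int) : ses_additive h -> h X0 = 0 ->
  forall Z, T Z -> wall Z = 0 -> h Z = 0.
Proof.
move=> hA hX0.
suff key n Z : T Z -> wall Z = 0 -> (`|w Z| < n)%N -> h Z = 0.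
  by move=> Z TZ eZ; apply: (key _ Z TZ eZ (ltnSn _)).
elim: n Z => [//|n IHn] Z TZ eZ wZ.
have [Z0|nZ] := pselect (is_zero Z); first exact: additive_zero.
have [f [FK nf]] := wall_socle TZ nZ eZ.
have TC := tp_quot tp (@cprj_surj _ _ _ _ f) TZ.
have ef := additive_map eA f; have eC := wall_T TC; have eK := wall_F FK.
(* Since [wall] vanishes on [X0] and [Z], it takes the same value on kernel and cokernel,
   nonnegative on the latter and negative on a nonzero object of [F]. *)
have K0 : is_zero (kerm f).
  have [//|nK] := pselect (is_zero (kerm f)).
  by have := wall_F_lt FK nK; move: wallX0; lia.
have hf := additive_map hA f; have wf := additive_map wA f.
rewrite (additive_zero hA K0) (additive_zero wA K0) hX0 in hf wf.
have wX : 0 < w X0 by case: sX0 => TX nX _; apply: wT.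
have hC : h (cokm f) = 0.
  apply: IHn => //; first by move: wallX0; lia.
  by have := weight_T wA wT TC; have := weight_T wA wT TZ; lia.
lia.
Qed.

Lemma wall_g_pos Z : T Z -> wall Z = 0 -> ~ is_zero Z -> 0 < g Z.
Proof.
move=> TZ eZ nZ; have wZ := wT TZ nZ.
have wX : 0 < w X0 by case: sX0 => TX nX _; apply: wT.
by move: eZ; rewrite /wall => /eqP; rewrite subr_eq0 => /eqP eZ;
  rewrite eZ pmulr_rgt0 in wZ.
Qed.

(** By simplicity of [X0] no object of [T] maps nontrivially into the kernel of a nonzero map, so
    the kernel is in [F]; then [wall (cokm f) = wall (kerm f) + wall Z] has sides of opposite
    sign. *)
Lemma X0_mut_Fsimple : Fsimple mut_T mut_F X0.
Proof.
split; [exact: mut_F_X0|by case: sX0|move=> Z f FZ TC [x fx]].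
have FK : F (kerm f).
  apply: (tp_F tp) => L u TL; apply: zero_mapP => -[l ul].
  have [v vE] := comp_exists (kinc f) u.
  have nv : nonzero_map v.
    exists l; rewrite vE => /(inj_eq0 (@kinc_inj _ _ _ _ f)); exact: ul.
  have [vs _] := Tsimple_strong tp sX0 TL nv.
  by apply: fx; have [y <-] := vs x; rewrite vE kincE.
have ef := additive_map eA f; have eK := wall_F FK; have eZ := wall_mut_F FZ.
move: ef; rewrite wallX0 => ef; apply: bij_injsurj.
  apply/kerm_zero; apply: contrapT => nK; have := wall_F_lt FK nK.
  have [C0|nC] := pselect (is_zero (cokm f)).
    by rewrite (additive_zero eA C0) in ef; lia.
  by have := wall_mut_T TC nC; lia.
by apply/cokm_zero; apply: contrapT => nC; have := wall_mut_T TC nC; lia.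
Qed.

(* In the heart of [(T, F)], a simple object [V'] or [Y'[1]] of the mutated
   heart other than [X0[1]] is an extension of a simple object [V] or [Y[1]] by
   an object of [T /\ mut_F], i.e. by an iterated self-extension of [X0]. *)
Definition relTT V' V := exists p : {linear V' -> V},
  [/\ surjective p, T (kerm p) & mut_F (kerm p)].
Definition relTF V' Y := exists Z (i : {linear Y -> Z}) (q : {linear Z -> V'}),
  [/\ short_exact i q, T Z & mut_F Z].
Definition relFF Y' Y := F Y' /\ exists f : {linear Y' -> Y},
  [/\ injective f, T (cokm f) & mut_F (cokm f)].

Lemma classify_T V' : Tsimple mut_T mut_F V' ->
  (exists V, [/\ Tsimple T F V, ~ iso V X0 & relTT V' V]) \/
  (exists Y, Fsimple T F Y /\ relTF V' Y).
Proof.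
move=> sV'; have [TV' nV' _] := sV'.
case: (heart_top tp wA wT wF (mut_T_T TV') nV').
  move=> [V [p [sV ps TK]]]; left; exists V; split=> //.
    move=> iV; have := tp_isoT tp' iV (tp_quot tp' ps TV') => TX.
    by have := tp_zero tp' TX mut_F_X0; case: sX0.
  (* A nonzero map from [mut_T] into the kernel would, composed with the inclusion, be surjective
     onto the simple [V'] and force [p] to vanish. *)
  exists p; split=> //; apply: (tp_F tp') => B u TB;
    apply: zero_mapP => -[b ub].
  have [v vE] := comp_exists (kinc p) u.
  have nv : nonzero_map v.
    exists b; rewrite vE => /(inj_eq0 (@kinc_inj _ _ _ _ p)); exact: ub.
  have [vs _] := Tsimple_strong tp' sV' TB nv.
  case: sV => _ nV _; apply: nV => y; have [x <-] := ps y; have [z <-] := vs x.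
  by rewrite vE kincE.
move=> [Y [Z1 [i [q [sY TZ1 iq]]]]]; right; exists Y; split=> //.
exists Z1, i, q; split=> //; have [ii exiq qs] := iq; have [FY nY _] := sY.
apply: (tp_F tp') => B u TB; apply: zero_mapP => -[b ub].
have [v vE] := comp_exists q u.
(* A nonzero [u] from [mut_T] to [Z1] would make [v] surjective with torsion kernel, so that [u]
   factors through a section [s] of [q]. Then [Y] is a summand of [Z1], thus both torsion and
   torsion-free. *)
have lift_u D (d : {linear D -> B}) : T D -> (forall x, v (d x) = 0) ->
    forall x, u (d x) = 0.
  move=> TD vd; have [ud udE] := comp_exists u d.
  have [|r rE] := @lift_inj _ _ _ _ _ i ud ii.
    by move=> x; apply/exiq; rewrite udE -vE.
  by move=> x; rewrite -udE -rE (tp_hom tp r TD FY) raddf0.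
have nv : nonzero_map v.
  apply: contrapT => /zero_mapP v0; apply: ub.
  have [idB idE] := id_exists B.
  by have := lift_u _ idB (mut_T_T TB) (fun x => v0 _) b; rewrite idE.
have [vs TKv] := Tsimple_strong tp' sV' TB nv.
have [|s sE] := @factor_surj _ _ _ _ _ v u vs.
  by move=> x /kincP[y <-]; apply: (lift_u _ (kinc v)) => [|z];
    [exact: mut_T_T|rewrite kincE].
have qs_ x : q (s x) = x by have [y <-] := vs x; rewrite sE vE.
have [|t tE] := @linear_exists _ _ Z1 Z1 (fun z => z - s (q z)).
  by move=> a x y; rewrite (linearP q) (linearP s) opprD addrACA -scalerBr.
have [|r rE] := @lift_inj _ _ _ _ _ i t ii.
  by move=> z; apply/exiq; rewrite tE raddfB /= qs_ subrr.
apply: nY => y; apply: (inj_eq0 ii).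
have : t (i y) = 0 by rewrite -rE (tp_hom tp r TZ1 FY) raddf0.
have -> : t (i y) = i y; last by [].
have qi : q (i y) = 0 by apply/exiq; exists y.
by rewrite tE qi (raddf0 s) subr0.
Qed.

(** If the part of [Y'] in [T] is zero, [Y'] lies in [F] and has a simple quotient there after a
    shift. Otherwise that part is on the wall and receives a map from [X0]. *)
Lemma classify_F Y' : Fsimple mut_T mut_F Y' ->
  iso X0 Y' \/ (exists Y, Fsimple T F Y /\ relFF Y' Y).
Proof.
move=> sY'; have [FY' nY' _] := sY'.
have [L [N [i [p [[ii ip ps] TL FN]]]]] := tp_dec tp Y'.
have [L0|nL] := pselect (is_zero L).
  have FY : F Y'.
    apply: (tp_sub tp (i := p)) FN; apply: linear_inj => y /ip[l <-].
    by rewrite (L0 l) raddf0.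
  right; have [V [f [sV TC nf]]] := heart_top_F tp wA wT wF FY nY'.
  have FV : F V by case: sV.
  have [fi FC] := Fsimple_strong tp' sY' (F_mut_F FV) nf.
  by exists V; split=> //; split=> //; exists f.
have [f [FK [x fx]]] := wall_socle TL nL (wall_T_mut_F TL (tp_sub tp' ii FY')).
have [h hE] := comp_exists i f.
have nh : nonzero_map h by exists x; rewrite hE => /(inj_eq0 ii).
have [hi FC] := Fsimple_strong tp' X0_mut_Fsimple FY' nh.
(* A nonzero map from [Y'] to [cokm h] would be injective, although it kills the image of [X0]. *)
left; exists h; apply: bij_injsurj => // y; apply/cprjP; move: y.
apply: zero_mapP => /(Fsimple_strong tp' sY' FC)[ci _].
case: nh => x' /(_ _)[]; apply: ci; rewrite raddf0; exact: cprjE.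
Qed.

(** The simple [V] is recovered from [E] as its torsion part: [L] meets [kerm a] trivially, and a
    nonzero map to [V] is surjective. *)
Lemma torsion_part_iso E L N V (i : {linear L -> E}) (p : {linear E -> N})
    (a : {linear E -> V}) : short_exact i p -> mut_T L -> mut_F N ->
  Tsimple mut_T mut_F V -> surjective a -> mut_F (kerm a) ->
    wall (kerm a) = 0 -> iso L V.
Proof.
move=> [ii ip ps] TL FN sV as_ FK eK; have [TV nV _] := sV.
have [u uE] := comp_exists a i.
have lift_i D (d : {linear D -> L}) : mut_T D -> (forall x, u (d x) = 0) ->
    forall x, d x = 0.
  move=> TD ud; have [id idE] := comp_exists i d.
  have [|r rE] := @lift_inj _ _ _ _ _ (kinc a) id (@kinc_inj _ _ _ _ a).
    by move=> x; apply/kincP; rewrite idE -uE.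
  by move=> x; apply: (inj_eq0 ii);
    rewrite -idE -rE (tp_hom tp' r TD FK) raddf0.
(* If [u] were zero, [E] would lie in [mut_F], yet [wall E = wall V > 0]. *)
have nu : nonzero_map u.
  apply: contrapT => /zero_mapP u0.
  have [idL idE] := id_exists L.
  have L0 : is_zero L by move=> x; rewrite -[x]idE; apply: lift_i.
  have FE : mut_F E.
    apply: (tp_sub tp' (i := p)) FN; apply: linear_inj => y /ip[l <-].
    by rewrite (L0 l) raddf0.
  by have := wall_mut_F FE; have := additive_surj eA as_; have :=
    wall_mut_T TV nV; lia.
have [us TKu] := Tsimple_strong tp' sV TL nu.
exists u; apply: bij_injsurj => //; apply: linear_inj => x /kincP[y <-].
by apply: (lift_i _ (kinc u)) => // z; rewrite kincE.
Qed.

Lemma common_cover_iso E V1 V2 (a1 : {linear E -> V1}) (a2 : {linear E -> V2}) :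
  Tsimple mut_T mut_F V1 -> Tsimple mut_T mut_F V2 -> surjective a1 ->
    surjective a2 ->
  mut_F (kerm a1) -> wall (kerm a1) = 0 -> mut_F (kerm a2) ->
    wall (kerm a2) = 0 ->
  iso V1 V2.
Proof.
move=> s1 s2 sa1 sa2 F1 e1 F2 e2.
have [L [N [i [p [ip TL FN]]]]] := tp_dec tp' E.
apply: iso_trans (torsion_part_iso ip TL FN s2 sa2 F2 e2).
exact/iso_sym/(torsion_part_iso ip TL FN s1 sa1 F1 e1).
Qed.

(** The fibre product over [V] covers [V1] and [V2], with kernels in [mut_F] and on the wall. *)
Lemma relTT_inj V1 V2 V : Tsimple mut_T mut_F V1 -> Tsimple mut_T mut_F V2 ->
  relTT V1 V -> relTT V2 V -> iso V1 V2.
Proof.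
move=> s1 s2 [p1 [p1s T1 F1]] [p2 [p2s T2 F2]].
have [D [a [b [q [bq aq ab _ a0]]]]] := ses_pullback p2 (ses_ker p1s).
have [bi exbq qs] := bq.
have as_ : surjective a.
  move=> x; have [y yE] := p2s (p1 x); have [d dE] := qs y.
  have /kincP[z zE] : p1 (x - a d) = 0 by rewrite raddfB /= aq dE yE subrr.
  by exists (b z + d); rewrite raddfD /= ab zE subrK.
have Fq : mut_F (kerm q) by apply: (tp_isoF tp' _ F1);
  exact: (kerm_iso bi exbq).
have eq0 : wall (kerm q) = 0.
  by rewrite -(additive_iso eA (kerm_iso bi exbq)); apply: wall_T_mut_F.
apply: (common_cover_iso (a1 := a) (a2 := q)) => //.
  have [u uE] := comp_exists q (kinc a).
  have [|r rE] := @lift_inj _ _ _ _ _ (kinc p2) u (@kinc_inj _ _ _ _ p2).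
    by move=> z; apply/kincP; rewrite uE -aq kincE raddf0.
  apply: (tp_sub tp' (i := r)) F2; apply: linear_inj => x rx.
  apply: (@kinc_inj _ _ _ _ a); rewrite raddf0; apply: a0; first exact: kincE.
  by rewrite -uE -rE rx raddf0.
have := additive_surj eA as_; have := additive_surj eA qs.
have := additive_surj eA p1s; have := additive_surj eA p2s.
by rewrite eq0 (wall_T_mut_F T1 F1) (wall_T_mut_F T2 F2); lia.
Qed.

(** The amalgamated sum of [Z1] and [Z2] along [Y] covers [V1] with kernel [Z2] and [V2] with kernel
    [Z1]. *)
Lemma relTF_inj V1 V2 Y : Tsimple mut_T mut_F V1 -> Tsimple mut_T mut_F V2 ->
  relTF V1 Y -> relTF V2 Y -> iso V1 V2.
Proof.
move=> s1 s2 [Z1 [i1 [q1 [iq1 T1 F1]]]] [Z2 [i2 [q2 [iq2 T2 F2]]]].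
have [D [a [b [q [c [bq qa cs ai]]]]]] := ses_pushout i2 iq1.
have [bi exbq qs] := bq; have [i2i ex2 q2s] := iq2.
have aI := ai i2i.
(* The comparison of cokernels is surjective by construction; a dimension count makes it
   injective. *)
have cb : bijective c.
  apply: bij_injsurj => //; apply: surj_dim_inj => //.
  have := mdim_inj aI; have := mdim_inj i2i; have := mdim_exact bq.
  by have := mdim_exact iq1; lia.
have i3 : iso (cokm a) V2.
  apply: (iso_trans (Y := cokm i2)); first by apply: iso_sym; exists c.
  exact: cokm_iso.
have [u ub] := i3; have [v vs vE] :=
  surj_comp_exists (@cprj_surj _ _ _ _ a) (bij_surj ub).
have iv : iso Z1 (kerm v).
  apply: (kerm_iso aI) => d; rewrite vE -cprjP.
  by split=> [/(inj_eq0 (bij_inj ub))|->] //; exact: raddf0.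
have iq : iso Z2 (kerm q) := kerm_iso bi exbq.
apply: (common_cover_iso (a1 := q) (a2 := v)) => //.
- exact: (tp_isoF tp' iq).
- by rewrite -(additive_iso eA iq); apply: wall_T_mut_F.
- exact: (tp_isoF tp' iv).
- by rewrite -(additive_iso eA iv); apply: wall_T_mut_F.
Qed.

(** A nonzero map from [Y1] to [cokm f2] would be injective with cokernel in [mut_F], and
    [wall (cokm f2)] would be negative instead of zero. Hence [f1] factors through [f2]. *)
Lemma relFF_lift Y1 Y2 Y (f1 : {linear Y1 -> Y}) (f2 : {linear Y2 -> Y}) :
  Fsimple mut_T mut_F Y1 -> F Y1 -> injective f1 -> injective f2 ->
  T (cokm f2) -> mut_F (cokm f2) -> exists h : {linear Y1 -> Y2}, injective h.
Proof.
move=> s1 FY1 i1 i2 T2 F2; have [_ nY1 _] := s1.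
have [r rE] := comp_exists (cprj f2) f1.
have r0 : forall y, r y = 0.
  apply: zero_mapP => /(Fsimple_strong tp' s1 F2)[ri FC].
  have := additive_inj eA ri; rewrite (wall_T_mut_F T2 F2).
  by have := wall_mut_F FC; have := wall_F_lt FY1 nY1; lia.
have [|h hE] := @lift_inj _ _ _ _ _ f2 f1 i2.
  by move=> y; apply/cprjP; rewrite -rE.
by exists h => x y e; apply: i1; rewrite -!hE e.
Qed.

Lemma relFF_inj Y1 Y2 Y : Fsimple mut_T mut_F Y1 -> Fsimple mut_T mut_F Y2 ->
  relFF Y1 Y -> relFF Y2 Y -> iso Y1 Y2.
Proof.
move=> s1 s2 [FY1 [f1 [i1 T1 F1]]] [FY2 [f2 [i2 T2 F2]]].
have [h hi] := relFF_lift s1 FY1 i1 i2 T2 F2.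
have [h' hi'] := relFF_lift s2 FY2 i2 i1 T1 F1.
exists h; apply: bij_injsurj => //; apply: inj_dim_surj => //.
by rewrite (mdim_inj hi') leq_addr.
Qed.

(** Otherwise [Y'] embeds into [Z], which is on the wall, with cokernel in [mut_F]; but
    [wall Y' < 0]. *)
Lemma relTF_relFF V' Y' Y : Fsimple mut_T mut_F Y' -> relTF V' Y ->
  relFF Y' Y -> False.
Proof.
move=> s' [Z [i [q [[ii _ _] TZ FZ]]]] [FY' [f [fi _ _]]].
have [FY'' nY' _] := s'.
have [u ui uE] := inj_comp_exists fi ii.
have nu : nonzero_map u.
  by have [y ny] := not_zeroP nY'; exists y => /(inj_eq0 ui).
have [_ FC] := Fsimple_strong tp' s' FZ nu.
have := additive_inj eA ui; rewrite (wall_T_mut_F TZ FZ).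
by have := wall_mut_F FC; have := wall_F_lt FY' nY'; lia.
Qed.
End Mutation.

(** * Jordan-Holder multiplicities *)

Section FiniteFamilies.
Variables (k : fieldType) (A : falgType k).
Implicit Types (P Q : fgmod A -> Prop).

Definition fin_classes P := exists n (B : 'I_n -> fgmod A),
  forall S, P S -> exists i, iso S (B i).

Lemma fin_classes0 P : (forall S, ~ P S) -> fin_classes P.
Proof.
by move=> nP; exists 0%N, (fun _ => regular_module A) => S /nP.
Qed.

Lemma fin_classes1 (X : fgmod A) : fin_classes (fun S => iso S X).
Proof. by exists 1%N, (fun _ => X) => S SX; exists ord0. Qed.

Lemma fin_classesU P Q R : fin_classes P -> fin_classes Q ->
  (forall S, R S -> P S \/ Q S) -> fin_classes R.
Proof.
move=> [n [B BP]] [m [C CQ]] RPQ.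
exists (n + m)%N, (fun i => match split i with inl i => B i | inr j => C j end).
move=> S /RPQ[/BP[i Si]|/CQ[i Si]].
  by exists (unsplit (inl i)); rewrite unsplitK.
by exists (unsplit (inr i)); rewrite unsplitK.
Qed.

Lemma fin_classes_bigU n (P : 'I_n -> fgmod A -> Prop) :
  (forall i, fin_classes (P i)) -> fin_classes (fun S => exists i, P i S).
Proof.
elim: n P => [|n IHn] P h; first by apply: fin_classes0 => S [[]].
apply: (fin_classesU (h ord0) (IHn (fun i => P (lift ord0 i)) _)).
  by move=> i; apply: h.
move=> S [i PS]; case: (unliftP ord0 i) PS => [j ->|->] PS; last by left.
by right; exists j.
Qed.

(* A covering family of minimal size has no repetition. *)
Lemma fin_classes_irredundant P : fin_classes P ->
  exists n (B : 'I_n -> fgmod A), [/\ forall i, P (B i),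
    forall i j, iso (B i) (B j) -> i = j & forall S, P S -> exists i,
      iso S (B i)].
Proof.
move=> fP; pose Q n := `[<exists B : 'I_n -> fgmod A,
  forall S, P S -> exists i, iso S (B i)>].
have exQ : exists n, Q n by case: fP => n hn; exists n; apply/asboolP.
case: (ex_minnP exQ) => n /asboolP[B BP] nmin.
have drop i : (forall S, P S -> iso S (B i) -> exists2 j, j != i &
  iso S (B j)) -> False.
  case: n B BP nmin i => [B _ _ []//|n] B BP nmin i h.
  suff : (n.+1 <= n)%N by rewrite ltnn.
  apply: nmin; apply/asboolP; exists (fun j => B (lift i j)) => S PS.
  have [j Sj] := BP S PS; case: (unliftP i j) Sj => [j' ->|-> Si];
    first by exists j'.
  have [j' j'i Sj'] := h S PS Si.
  case: (unliftP i j') Sj' j'i => [j'' -> Sj''|->]; first by exists j''.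
  by rewrite eqxx.
have /choice[C CP] : forall i, exists S, P S /\ iso S (B i).
  move=> i; apply: contrapT => hn; apply: (drop i) => S PS Si.
  by case: hn; exists S.
exists n, C; split=> [i|i j ij|S PS]; first exact: (proj1 (CP i)).
  apply: contrapT => /eqP nij; apply: (drop i) => S PS Si.
  exists j; first by rewrite eq_sym.
  apply: iso_trans Si _; apply: iso_trans (iso_sym (proj2 (CP i))) _.
  exact: iso_trans ij (proj2 (CP j)).
have [i Si] := BP S PS; exists i; exact: iso_trans Si (iso_sym (proj2 (CP i))).
Qed.
End FiniteFamilies.

Section JordanHolder.
Variables (k : fieldType) (A : falgType k).
Implicit Types X Y Z M N L E Q I K C D W B V S : fgmod A.

Definition simple S := ~ is_zero S /\
  forall L (i : {linear L -> S}), injective i -> ~ is_zero L -> surjective i.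

Lemma map_to_simple X S (f : {linear X -> S}) :
  simple S -> nonzero_map f -> surjective f.
Proof.
move=> [_ sS] [x fx]; have [I [p [i [ps ii ip]]]] := image_exists f.
have is_ : surjective i.
  by apply: sS => // I0; apply: fx; rewrite -ip (I0 (p x)) raddf0.
by move=> y; have [z <-] := is_ y; have [z' <-] := ps z; exists z'; rewrite ip.
Qed.

Lemma map_from_simple S X (f : {linear S -> X}) :
  simple S -> nonzero_map f -> injective f.
Proof.
move=> [_ sS] [x fx]; apply/kerm_zero; apply: contrapT => nK; apply: fx.
by have [y <-] := sS _ _ (@kinc_inj _ _ _ _ f) nK x; rewrite kincE.
Qed.

Lemma simple_quotient X : ~ is_zero X ->
  exists S (p : {linear X -> S}), simple S /\ surjective p.
Proof.
move=> nX; have [|S [[p [ps nS]] Smin]] := @min_measure _ A (@mdim _ A)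
    (fun S => exists p : {linear X -> S}, surjective p /\ ~ is_zero S).
  by have [f fE] := id_exists X; exists X, f; split=> // x; exists x;
    rewrite fE.
exists S, p; split=> //; split=> // L i ii nL; apply/cokm_zero.
apply: contrapT => nC.
have [u us _] := surj_comp_exists ps (@cprj_surj _ _ _ _ i).
have : (mdim S <= mdim (cokm i))%N by apply: Smin; exists u.
by rewrite (mdim_inj ii); move: (mdim_gt0 nL); lia.
Qed.

(** Fix one simple quotient [S1]. A simple quotient not isomorphic to it is nonzero on [kerm p1], so
    it is already a quotient of this smaller module. *)
Lemma simple_quotients_fin M : fin_classes (fun S => simple S /\
  exists p : {linear M -> S}, surjective p).
Proof.
have [n] := ubnP (mdim M); elim: n M => [//|n IHn] M Mn.
have [M0|nM] := pselect (is_zero M).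
  apply: fin_classes0 => S [[nS _] [p ps]]; apply: nS => y.
  by have [x <-] := ps y; rewrite (M0 x) raddf0.
have [S1 [p1 [s1 p1s]]] := simple_quotient nM.
have [|n1 [B BP]] := IHn (kerm p1).
  by have := mdim_surj p1s; have := mdim_gt0 (proj1 s1); lia.
apply: (fin_classesU (fin_classes1 S1) (ex_intro _ n1 (ex_intro _ B BP))).
move=> S [sS [p ps]]; have [u uE] := comp_exists p (kinc p1).
have [nu|/zero_mapP u0] := pselect (nonzero_map u).
  by right; split=> //; exists u; apply: map_to_simple.
left; have [|h hE] := @factor_surj _ _ _ _ _ p1 p p1s.
  by move=> x /kincP[y <-]; rewrite -uE.
have hs : surjective h by move=> y; have [x <-] := ps y; exists (p1 x).
apply: iso_sym; exists h; apply: bij_injsurj => //; apply: (map_from_simple s1).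
have [y ny] := not_zeroP (proj1 sS); have [x xE] := hs y.
by exists x; rewrite xE.
Qed.

Lemma simple_fin : fin_classes simple.
Proof.
have [n [B BP]] := simple_quotients_fin (regular_module A).
exists n, B => S sS; apply: BP; split=> //.
have [x nx] := not_zeroP (proj1 sS).
have [|f fE] := @linear_exists _ _ (regular_module A) S (fun a : A^c => a *: x).
  by move=> a b c; rewrite scalerDl; congr (_ + _);
    exact: (esym (scalerA _ _ _)).
exists f; apply: map_to_simple => //; exists (1 : A^c).
by rewrite fE scale1r.
Qed.

Section Multiplicity.
Variable S0 : fgmod A.

Definition iso_ind S : int := if `[<iso S S0>] then 1 else 0.

(** The multiplicity of [S0] read off from one composition series; a relation, because independence
    of the series is still to be shown. *)
Inductive mult : fgmod A -> int -> Prop :=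
| mult_zero X : is_zero X -> mult X 0
| mult_cons X Y S (f : {linear Y -> X}) (p : {linear X -> S}) v :
    short_exact f p -> simple S -> mult Y v -> mult X (v + iso_ind S).

Lemma iso_ind_iso S S' : iso S S' -> iso_ind S = iso_ind S'.
Proof.
move=> i; rewrite /iso_ind; congr (if _ then _ else _); apply/asbool_equiv_eq.
by split; [apply: iso_trans (iso_sym i)|apply: iso_trans i].
Qed.

Lemma mult_exists X : exists v, mult X v.
Proof.
have [n] := ubnP (mdim X); elim: n X => [//|n IHn] X Xn.
have [X0|nX] := pselect (is_zero X); first by exists 0; apply: mult_zero.
have [S [p [sS ps]]] := simple_quotient nX.
have [|v hv] := IHn (kerm p).
  by have := mdim_surj ps; have := mdim_gt0 (proj1 sS); lia.
by exists (v + iso_ind S); apply: mult_cons (ses_ker ps) sS hv.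
Qed.

Lemma mult_iso X X' v : iso X X' -> mult X v -> mult X' v.
Proof.
move=> iX h; case: h iX => [{}X X0|{}X Y S f p {}v [fi fp ps] sS hY] iX.
  exact/mult_zero/(iso_is_zero iX).
have [u ub] := iX; have [u' u'b] := iso_sym iX.
move: ub => [r ur ru].
have [|t tE] := @linear_exists _ _ X' X r.
  by move=> a x y; rewrite -[RHS]ur linearP !ru.
have [f' f'E] := comp_exists u f; have [p' p'E] := comp_exists p t.
apply: (mult_cons (f := f') (p := p')) => //; split.
- by move=> x y; rewrite !f'E => /(can_inj ur)/fi.
- move=> y; rewrite p'E tE; split=> [/fp[x xE]|[x <-]].
    by exists x; rewrite f'E xE ru.
  by rewrite f'E ur; apply/fp; exists x.
by move=> s; have [x <-] := ps s; exists (u x); rewrite p'E tE ur.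
Qed.

Lemma mult_not_zero X Y S (f : {linear Y -> X}) (p : {linear X -> S}) :
  short_exact f p -> simple S -> ~ is_zero X.
Proof.
move=> [_ _ ps] [nS _] X0; apply: nS => y.
by have [x <-] := ps y; rewrite (X0 x) raddf0.
Qed.

Lemma maximal_sub_le X Y1 Y2 S1 S2 (f1 : {linear Y1 -> X}) (p1 :
  {linear X -> S1})
    (f2 : {linear Y2 -> X}) (p2 : {linear X -> S2}) :
  short_exact f1 p1 -> simple S1 -> short_exact f2 p2 -> simple S2 ->
  (forall y, p2 (f1 y) = 0) ->
  iso S1 S2 /\ exists2 h : {linear Y1 -> Y2}, bijective h & forall y,
    f2 (h y) = f1 y.
Proof.
move=> e1 s1 e2 s2 p20; have [f1i fp1 p1s] := e1; have [f2i fp2 p2s] := e2.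
have [|h hE] := @factor_surj _ _ _ _ _ p1 p2 p1s.
  by move=> x /fp1[y <-].
have hs : surjective h by move=> y; have [x <-] := p2s y; exists (p1 x).
have iS : iso S1 S2.
  exists h; apply: bij_injsurj => //; apply: (map_from_simple s1).
  have [y ny] := not_zeroP (proj1 s2); have [x xE] := hs y.
  by exists x; rewrite xE.
split=> //; have [|l lE] := @lift_inj _ _ _ _ _ f2 f1 f2i.
  by move=> z; apply/fp2.
exists l => //; have li : injective l by move=> x y e; apply: f1i;
  rewrite -!lE e.
apply: bij_injsurj => //; apply: inj_dim_surj => //.
by have := mdim_exact e1; have := mdim_exact e2; rewrite (mdim_iso iS); lia.
Qed.

(** Jordan-Holder by induction on dimension: two maximal subobjects coincide or are compared through
    their intersection. *)
Lemma mult_unique X a b : mult X a -> mult X b -> a = b.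
Proof.
have [n] := ubnP (mdim X); elim: n X a b => [//|n IHn] X a b Xn ha.
case: ha Xn => [{}X X0|{}X Y1 S1 f1 p1 v1 e1 s1 m1] Xn hb.
  case: hb X0 {Xn} => [//|{}X Y2 S2 f2 p2 v2 e2 s2 m2] X0.
  by case: (mult_not_zero e2 s2).
case: hb Xn f1 p1 e1 => [{}X X0|{}X Y2 S2 f2 p2 v2 e2 s2 m2] Xn f1 p1 e1.
  by case: (mult_not_zero e1 s1).
have d1 : (mdim Y1 < n)%N.
  by have := mdim_exact e1; have := mdim_gt0 (proj1 s1); lia.
have d2 : (mdim Y2 < n)%N.
  by have := mdim_exact e2; have := mdim_gt0 (proj1 s2); lia.
have [u uE] := comp_exists p2 f1; have [t tE] := comp_exists p1 f2.
have [nu|/zero_mapP u0] := pselect (nonzero_map u); last first.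
  have [|iS [h hb _]] := maximal_sub_le e1 s1 e2 s2; first by move=> y;
    rewrite -uE.
  rewrite (iso_ind_iso iS); congr (_ + _); apply: (IHn Y2) => //.
  by apply: mult_iso m1; exists h.
have us := map_to_simple s2 nu.
have nt : nonzero_map t.
  apply: contrapT => /zero_mapP t0; case: nu => y; apply.
  have [|_ [h hb hE]] := maximal_sub_le e2 s2 e1 s1; first by move=> z;
    rewrite -tE.
  have [z <-] := bij_surj hb y; rewrite uE hE.
  by have [_ fp2 _] := e2; apply/fp2; exists z.
have ts := map_to_simple s1 nt.
have [f1i fp1 p1s] := e1; have [f2i fp2 p2s] := e2.
(* [kerm u] is the intersection of [Y1] and [Y2]; the quotients of [Y1] and [Y2] by it are [S2] and
   [S1]. *)
have [v hv] := mult_exists (kerm u).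
have -> : v1 = v + iso_ind S2 by apply: (IHn Y1) m1 _ => //;
  apply: mult_cons (ses_ker us) s2 hv.
have [fk fkE] := comp_exists f1 (kinc u).
have [|j jE] := @lift_inj _ _ _ _ _ f2 fk f2i.
  by move=> z; apply/fp2; rewrite fkE -uE kincE.
have -> : v2 = v + iso_ind S1; last by rewrite -!addrA [iso_ind S2 + _]addrC.
apply: (IHn Y2) m2 _ => //; apply: (mult_cons (f := j) (p := t)) hv => //;
  split=> //.
  move=> x y e; apply: (@kinc_inj _ _ _ _ u); apply: f1i.
  by rewrite -!fkE -!jE e.
move=> y; rewrite tE; split=> [/fp1[y1 y1E]|[x <-]].
  have /kincP[z zE] : u y1 = 0 by rewrite uE y1E; apply/fp2; exists y.
  by exists z; apply: f2i; rewrite jE fkE zE y1E.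
by rewrite jE fkE; apply/fp1; exists (kinc u x).
Qed.

Lemma mult_add X Y Z (f : {linear X -> Y}) (g : {linear Y -> Z}) a b :
  short_exact f g -> mult X a -> mult Z b -> mult Y (a + b).
Proof.
move=> fg hX hZ; elim: hZ Y f g fg =>
    {Z b} [Z Z0|Z Z' S j p v jp sS hZ' IH] Y f g fg.
  rewrite addr0; apply: mult_iso hX; have [fi exfg _] := fg.
  by exists f; apply: bij_injsurj => // y; apply/exfg/Z0.
have [D [d [c [q [cq gd dc di _]]]]] := ses_pullback j fg.
have [ji exjp ps] := jp; have [ci excq qs] := cq; have [fi exfg gs] := fg.
have [pg pgs pgE] := surj_comp_exists gs ps.
rewrite addrA; apply: (mult_cons (f := d) (p := pg)) (IH _ _ _ cq) => //.
split=> //; first exact: di.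
move=> y; rewrite pgE; split=> [/exjp[e eE]|[x <-]]; last first.
  by rewrite gd; apply/exjp; exists (q x).
have [x xE] := qs e.
have /exfg[z zE] : g (y - d x) = 0 by rewrite raddfB /= gd xE eE subrr.
by exists (c z + x); rewrite raddfD /= dc zE subrK.
Qed.

Lemma multiplicity_exists : exists h : fgmod A -> int, ses_additive h /\
  forall S, simple S -> h S = iso_ind S.
Proof.
have [h hP] := choice mult_exists; exists h; split=> [X Y Z f g fg|S sS].
  exact: mult_unique (hP Y) (mult_add fg (hP X) (hP Z)).
apply: mult_unique (hP S) _; rewrite -[iso_ind S]add0r.
have [f fE] := id_exists S.
have fs : surjective f by move=> x; exists x.
apply: (mult_cons (ses_ker fs) sS); apply: mult_zero; apply/kerm_zero => x y.
by rewrite !fE.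
Qed.
End Multiplicity.

(** The length of an object is at most its dimension, and [C] bounds [h] on all of the finitely many
    simple modules. *)
Lemma additive_bound (h : fgmod A -> int) : ses_additive h ->
  exists C : nat, forall X, (`|h X| <= C * mdim X)%N.
Proof.
move=> hA; have [m [B BP]] := simple_fin.
exists (\sum_i `|h (B i)|)%N => X.
have [n] := ubnP (mdim X); elim: n X => [//|n IHn] X Xn.
have [X0|nX] := pselect (is_zero X); first by rewrite (additive_zero hA).
have [S [p [sS ps]]] := simple_quotient nX.
have dS := mdim_surj ps; have gS := mdim_gt0 (proj1 sS).
have hS : (`|h S| <= \sum_i `|h (B i)|)%N.
  have [i Si] := BP S sS; rewrite (additive_iso hA Si) (bigD1 i) //=.
  by rewrite leq_addr.
have hX := additive_surj hA ps.
have : (`|h (kerm p)| <= (\sum_i `|h (B i)|) * mdim (kerm p))%N.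
  by apply: IHn; lia.
move: hS; set C := (\sum_i _)%N => hS hK.
have : (C * mdim (kerm p) + C <= C * mdim X)%N.
  by rewrite dS mulnDr leq_add2l leq_pmulr.
lia.
Qed.
End JordanHolder.

(** * Mutation of dual bases *)

Section DualBases.
Variables (k : fieldType) (A : falgType k).
Implicit Types X Y Z M N L E Q I K C D W B S : fgmod A.

Definition sign_of (b : bool) : int := if b then 1 else -1.

(* The signed classes [sign_of (e j) [V j]] of the simple objects of the heart
   are dual to the [g i]. Some [V j] may be junk, representing no simple. *)
Record dual_basis (T F : fgmod A -> Prop) n (V : 'I_n -> fgmod A)
    (e : 'I_n -> bool) (g : 'I_n -> fgmod A -> int) : Prop := DualBasis {
  db_additive : forall i, ses_additive (g i);
  db_dual : forall i j, g i (V j) = if i == j then sign_of (e j) else 0;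
  db_T : forall X, Tsimple T F X -> exists j, e j /\ iso X (V j);
  db_F : forall Y, Fsimple T F Y -> exists j, ~~ e j /\ iso Y (V j) }.

Section Step.
Variables (T F : fgmod A -> Prop).
Hypothesis tp : torsion_pair T F.
Variable w : fgmod A -> int.
Hypothesis wA : ses_additive w.
Hypothesis wT : forall X, T X -> ~ is_zero X -> 0 < w X.
Hypothesis wF : forall X, F X -> ~ is_zero X -> w X < 0.
Variables (n : nat) (V : 'I_n -> fgmod A) (e : 'I_n -> bool).
Variable g : 'I_n -> fgmod A -> int.
Hypothesis db : dual_basis T F V e g.
Variables (X0 : fgmod A) (j0 : 'I_n).
Hypothesis sX0 : Tsimple T F X0.
Hypothesis iX0 : iso X0 (V j0).
Hypothesis ej0 : e j0.

Let gA : ses_additive (g j0) := db_additive db j0.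

Let gX0 : g j0 X0 = 1.
Proof. by rewrite (additive_iso gA iX0) (db_dual db) eqxx ej0. Qed.

Let gT W : Tsimple T F W -> ~ iso W X0 -> g j0 W = 0.
Proof.
move=> sW nW; have [j [ej Wj]] := db_T db sW.
rewrite (additive_iso gA Wj) (db_dual db); case: eqP => // jj0.
by case: nW; apply: iso_trans Wj _; rewrite -jj0; apply: iso_sym.
Qed.

Let gF W : Fsimple T F W -> g j0 W = 0.
Proof.
move=> sW; have [j [ej Wj]] := db_F db sW.
rewrite (additive_iso gA Wj) (db_dual db); case: eqP => // jj0.
by rewrite -jj0 ej0 in ej.
Qed.

Let w' := wall w X0 (g j0).
Let T1 := mut_T w X0 (g j0).
Let F1 := mut_F w X0 (g j0).
Let eA : ses_additive w' := wall_additive wA _ gA.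
Let tp1 : torsion_pair T1 F1 := torsion_pair_T_Fb eA.
Let classT := classify_T tp wA wT wF sX0 gA gX0 gT gF.
Let classF := classify_F tp wA wT wF sX0 gA gX0 gT gF.
Let eTF := wall_T_mut_F tp wA wT wF gA gX0 gT gF.

Let gX0' i : i != j0 -> g i X0 = 0.
Proof.
move=> ij; rewrite (additive_iso (db_additive db i) iX0) (db_dual db).
by rewrite (negPf ij).
Qed.

Let g_eq0 i Z : i != j0 -> T Z -> F1 Z -> g i Z = 0.
Proof.
move=> ij TZ FZ; apply: (wall_eq0 tp wA wT wF sX0 gA gX0 gT gF) => //.
- exact: db_additive db i.
- exact: gX0'.
- exact: eTF.
Qed.

(** Records the index of the old simple object from which [U] arises; the sign says whether that one
    lies in [T] or in [F[1]]. *)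
Let relT U j := if e j then relTT T w X0 (g j0) U (V j)
                else relTF T w X0 (g j0) U (V j).
Let relF U j := ~~ e j /\ relFF T F w X0 (g j0) U (V j).

(** [U] differs from the old simple object only by copies of [X0], which coordinates other than [j0]
    do not see. *)
Let relT_dual U i j : i != j0 -> relT U j -> g i U = if i == j then 1 else 0.
Proof.
move=> ij; have giA := db_additive db i; rewrite /relT; case ej : (e j).
  move=> [p [ps TK FK]]; have := additive_surj giA ps.
  by rewrite (g_eq0 ij TK FK) (db_dual db) ej add0r => <-.
move=> [Z [a [q [aq TZ FZ]]]]; have := giA _ _ _ _ _ aq.
rewrite (g_eq0 ij TZ FZ) (db_dual db) ej.
by case: (i == j) => /=; lia.
Qed.

Let relF_dual U i j : i != j0 -> relF U j -> g i U = if i == j then -1 else 0.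
Proof.
move=> ij [ej [_ [f [fi TC FC]]]]; have giA := db_additive db i.
have := additive_inj giA fi.
by rewrite (g_eq0 ij TC FC) (db_dual db) (negPf ej) addr0 => <-.
Qed.

Let relT_ex U : Tsimple T1 F1 U -> exists2 j, j != j0 & relT U j.
Proof.
move=> sU; case: (classT sU) =>
    [[W [sW nW [p [ps TK FK]]]]|[Y [sY [Z [i [q [iq TZ FZ]]]]]]].
  have [j [ej Wj]] := db_T db sW; exists j.
    by apply/eqP => jj; apply: nW; apply: iso_trans Wj _; rewrite jj;
      apply: iso_sym.
  have [u ub] := Wj; have [up ups upE] := surj_comp_exists ps (bij_surj ub).
  rewrite /relT ej; exists up.
  have iK : iso (kerm p) (kerm up).
    apply: kerm_iso; first exact: kinc_inj.
    move=> x; rewrite -kincP upE; split=> [/(inj_eq0 (bij_inj ub))//|->].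
    exact: raddf0.
  by split=> //; [apply: (tp_isoT tp iK)|apply: (tp_isoF tp1 iK)].
have [j [ej Wj]] := db_F db sY; exists j.
  by apply/eqP => jj; rewrite jj ej0 in ej.
rewrite /relT (negPf ej); have [u ub] := iso_sym Wj.
have [ii exiq qs] := iq; have [iu iui iuE] := inj_comp_exists (bij_inj ub) ii.
exists Z, iu, q; split=> //; split=> // z; split=> [/exiq[y <-]|[x <-]].
  by have [x <-] := bij_surj ub y; exists x; rewrite iuE.
by rewrite iuE; apply/exiq; exists (u x).
Qed.

Let relF_ex U : Fsimple T1 F1 U -> iso X0 U \/ exists2 j, j != j0 & relF U j.
Proof.
move=> sU; case: (classF sU) => [|[Y [sY [FU [f [fi TC FC]]]]]]; first by left.
right; have [j [ej Wj]] := db_F db sY; exists j.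
  by apply/eqP => jj; rewrite jj ej0 in ej.
split=> //; split=> //; have [u ub] := Wj.
have [uf ufi ufE] := inj_comp_exists fi (bij_inj ub); exists uf.
have iC : iso (cokm f) (cokm uf).
  have [v vb] := iso_sym Wj.
  have [c cs cE] := surj_comp_exists (bij_surj ub) (@cprj_surj _ _ _ _ uf).
  apply: (cokm_iso (p := c)) => // y; rewrite cE cprjP.
  split=> [[x]|[x <-]]; last by exists x; rewrite ufE.
  by rewrite ufE => /(bij_inj ub) <-; exists x.
by split=> //; [apply: (tp_isoT tp iC)|apply: (tp_isoF tp1 iC)].
Qed.

Let relT_inj U1 U2 j : Tsimple T1 F1 U1 -> Tsimple T1 F1 U2 ->
  relT U1 j -> relT U2 j -> iso U1 U2.
Proof.
move=> s1 s2; rewrite /relT; case: (e j).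
  exact: (relTT_inj tp wA wT wF gA gX0 gT gF s1 s2).
exact: (relTF_inj tp wA wT wF gA gX0 gT gF s1 s2).
Qed.

(** Up to isomorphism at most one simple object of the mutated heart is related to [j], in [T1] or,
    shifted, in [F1]. If there is none, the old class and sign stay as junk to keep the duality. *)
Let mutate j : j != j0 -> exists vb : fgmod A * bool,
  [/\ forall i, i != j0 -> g i vb.1 = if i == j then sign_of vb.2 else 0,
      forall U, Tsimple T1 F1 U -> relT U j -> vb.2 /\ iso U vb.1 &
      forall U, Fsimple T1 F1 U -> relF U j -> ~~ vb.2 /\ iso U vb.1].
Proof.
move=> jj.
have noTF U U' : relT U j -> Fsimple T1 F1 U' -> relF U' j -> False.
  rewrite /relT => h s' [/negPf ej r']; rewrite ej in h.
  exact: (relTF_relFF tp wA wT wF gA gX0 gT gF s' h r').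
have [[U [sU rU]]|nT] := pselect (exists U, Tsimple T1 F1 U /\ relT U j).
  exists (U, true); split=> /=.
  - by move=> i ij; apply: relT_dual.
  - by move=> U' sU' rU'; split=> //; apply: relT_inj rU' rU.
  - by move=> U' sU' rU'; case: (noTF _ _ rU sU' rU').
have [[U [sU rU]]|nF] := pselect (exists U, Fsimple T1 F1 U /\ relF U j).
  exists (U, false); split=> /=.
  - by move=> i ij; apply: relF_dual.
  - by move=> U' sU' rU'; case: nT; exists U'.
  - move=> U' sU' [_ rU']; split=> //; case: rU => _ rU.
    exact: (relFF_inj tp wA wT wF gA gX0 gT gF sU' sU rU' rU).
exists (V j, e j); split=> /=.
- by move=> i _; rewrite (db_dual db).
- by move=> U sU rU; case: nT; exists U.
- by move=> U sU rU; case: nF; exists U.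
Qed.

Lemma dual_basis_mutation : exists V' e' g', @dual_basis T1 F1 n V' e' g'.
Proof.
have /choice[vb vbP] : forall j, exists vb : fgmod A * bool, j != j0 ->
  [/\ forall i, i != j0 -> g i vb.1 = if i == j then sign_of vb.2 else 0,
      forall U, Tsimple T1 F1 U -> relT U j -> vb.2 /\ iso U vb.1 &
      forall U, Fsimple T1 F1 U -> relF U j -> ~~ vb.2 /\ iso U vb.1].
  move=> j; have [->|jj] := eqVneq j j0; first by exists (X0, true).
  by have [x xP] := mutate jj; exists x.
pose V' j := if j == j0 then X0 else (vb j).1.
pose e' j := if j == j0 then false else (vb j).2.
(* Coordinates other than [j0] are dual to the new classes already. The sign of [X0] has flipped,
   hence [- g j0]; the coefficients [c j] cancel its values on the other new classes. *)
pose c j := sign_of (e' j) * g j0 (V' j).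
pose g' i Z :=
  if i == j0 then - g j0 Z + \sum_(j | j != j0) c j * g j Z else g i Z.
exists V', e', g'; split.
- move=> i; rewrite /g'; case: (i == j0); last exact: db_additive db i.
  move=> X Y Z f h fh; rewrite (gA fh).
  under eq_bigr => j _ do rewrite (db_additive db j fh) mulrDr.
  by rewrite big_split /= opprD addrACA.
- move=> i j; rewrite /g'; have [->|ij] := eqVneq i j0; last first.
    rewrite /V' /e'; have [->|jj] := eqVneq j j0.
      by rewrite gX0' // (negPf ij).
    by have [h _ _] := vbP j jj; rewrite h.
  have [->|jj] := eqVneq j j0.
    rewrite {1 2}/V' eqxx gX0 big1 ?addr0 ?eqxx; first by rewrite /e' eqxx.
    by move=> i' ij'; rewrite gX0' ?mulr0.
  have [h _ _] := vbP j jj.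
  rewrite (bigD1 j) //= big1 ?addr0; last first.
    by move=> i' /andP[ij' /negPf i'j]; rewrite /V' (negPf jj) h // i'j mulr0.
  have -> : g j (V' j) = sign_of (e' j).
    by rewrite /V' /e' (negPf jj) h // eqxx.
  by rewrite /c /sign_of; case: (e' j); lia.
- move=> X sX; have [j jj rX] := relT_ex sX; have [_ h _] := vbP j jj.
  by exists j; rewrite /e' /V' (negPf jj); apply: h.
- move=> Y sY; case: (relF_ex sY) => [iY|[j jj rY]].
    by exists j0; rewrite /e' /V' eqxx; split=> //; apply: iso_sym.
  have [_ _ h] := vbP j jj.
  by exists j; rewrite /e' /V' (negPf jj); apply: h.
Qed.

Lemma mutated_T_sub Z : T1 Z -> T Z.
Proof. exact: (mut_T_T tp wA wT wF gA gX0 gT gF). Qed.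

Lemma mutated_F_sup Z : F Z -> F1 Z.
Proof. by move=> FZ; apply: (F_mut_F tp wA wT wF gA gX0 gT gF FZ). Qed.

Lemma mutated_F_simple : F1 X0.
Proof. exact: (mut_F_X0 tp wA wT wF sX0 gA gX0 gT gF). Qed.

Lemma mutated_T_orth Z : T Z ->
  (forall f : {linear Z -> X0}, ~ nonzero_map f) -> T1 Z.
Proof. by move=> TZ h; apply: (T_mut_T tp wA wT wF gA gX0 gT gF TZ h). Qed.

(** A multiple by [m] of the point [w - (w X0 + 1/m) g] on the ray, just past the wall; the scaling
    keeps the values integral. *)
Definition beyond_wall (m : nat) Z : int := m%:Z * w' Z - g j0 Z.

Lemma beyond_wall_additive m : ses_additive (beyond_wall m).
Proof. by move=> X Y Z f h fh; rewrite /beyond_wall (eA fh) (gA fh); lia. Qed.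

(** A nonzero quotient [N] has [w' N >= 1] by integrality, while [g j0 N] is bounded through the
    dimension of [Z]; one threshold serves all quotients. *)
Lemma beyond_wall_T Z : T1 Z ->
  exists m0, forall m, (m0 <= m)%N -> nT (beyond_wall m) Z.
Proof.
move=> TZ; have [C CP] := additive_bound gA.
exists (C * mdim Z).+1 => m hm N p ps nN.
have wN : 0 < w' N := TZ N p ps nN.
have gN := CP N; have dN := mdim_surj ps.
have CN : (C * mdim N <= C * mdim Z)%N by rewrite leq_mul2l dN leq_addl orbT.
rewrite /beyond_wall.
have : m%:Z <= m%:Z * w' N by rewrite ler_peMr // lez0_nat.
lia.
Qed.

(** Where [w' N <= -1] the same bound decides. Where [w' N = 0], [N] lies in [T], because [w'] is
    negative on nonzero objects of [F], and there [g j0] is positive. *)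
Lemma beyond_wall_F Z : F1 Z ->
  exists m0, forall m, (m0 <= m)%N -> nF (beyond_wall m) Z.
Proof.
move=> FZ; have [C CP] := additive_bound gA.
exists (C * mdim Z).+1 => m hm N p ps nN.
have wN : w' N <= 0 := FZ N p ps.
have gN := CP N; have dN := mdim_inj ps.
have CN : (C * mdim N <= C * mdim Z)%N by rewrite leq_mul2l dN leq_addr orbT.
rewrite /beyond_wall; have FN : F1 N := tp_sub tp1 ps FZ.
have [eN|nN'] := eqVneq (w' N) 0.
  rewrite eN mulr0 sub0r oppr_lt0.
  have [L [Q [i [q [iq TL FQ]]]]] := tp_dec tp N.
  have wL : 0 <= w' L by exact: (wall_T tp wA wT wF gA gX0 gT gF TL).
  have wQ : w' Q <= 0 by exact: (wall_F tp wA wT wF gA gX0 gT gF FQ).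
  have FL : F1 L by have [ii _ _] := iq; exact: (tp_sub tp1 ii FN).
  have Q0 : is_zero Q.
    apply: contrapT => nQ.
    have := wall_F_lt tp wA wT wF gA gX0 gT gF FQ nQ; rewrite -/w'.
    have eL : w' L = 0 := eTF TL FL.
    by have : w' N = w' L + w' Q := eA iq; rewrite eN eL; lia.
  have TN : T N.
    have [ii exiq _] := iq; apply: (tp_quot tp (p := i)) TL => x; exact/exiq/Q0.
  exact: (wall_g_pos wT sX0 TN eN nN).
have : m%:Z * w' N <= - m%:Z.
  have : w' N <= -1 by lia.
  by move=> h; rewrite -mulrN1 ler_wpM2l.
lia.
Qed.
End Step.
End DualBases.

(** * Bricks of a chamber *)

Section BricksGenerating.
Variables (k : fieldType) (A : falgType k).
Implicit Types X Y Z M N L E Q I K C D W B S : fgmod A.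
Variables (T F : fgmod A -> Prop).
Hypothesis tp : torsion_pair T F.
Variable w : fgmod A -> int.
Hypothesis wA : ses_additive w.
Hypothesis wT : forall X, T X -> ~ is_zero X -> 0 < w X.
Hypothesis wF : forall X, F X -> ~ is_zero X -> w X < 0.

(* The objects of the smallest torsion class containing [S]. *)
Definition reached_from S Z := forall N (p : {linear Z -> N}),
  surjective p -> ~ is_zero N -> exists f : {linear S -> N}, nonzero_map f.

Lemma reached_quot S X Y (p : {linear X -> Y}) :
  surjective p -> reached_from S X -> reached_from S Y.
Proof. by move=> ps RX N q qs; have [u us _] := surj_comp_exists ps qs;
  apply: RX us. Qed.

Lemma reached_ext S X Y Z (f : {linear X -> Y}) (g : {linear Y -> Z}) :
  short_exact f g -> reached_from S X -> reached_from S Z -> reached_from S Y.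
Proof.
move=> fg RX RZ N p ps nN; have [fi exfg gs] := fg.
have [pf pfE] := comp_exists p f.
have [I [a [i [as_ ii ai]]]] := image_exists pf.
have [I0|nI] := pselect (is_zero I).
  have [|h hE] := @factor_surj _ _ _ _ _ g p gs.
    by move=> y /exfg[x <-]; rewrite -pfE -ai (I0 (a x)) raddf0.
  by apply: (RZ _ h) => // n; have [y <-] := ps n; exists (g y); rewrite hE.
have [h [s hs]] := RX _ a as_ nI.
have [ih ihE] := comp_exists i h.
by exists ih, s; rewrite ihE => /(inj_eq0 ii).
Qed.

Lemma reached_map S X Y (f : {linear X -> Y}) :
  reached_from S X -> reached_from S (cokm f) -> reached_from S Y.
Proof.
move=> RX RC; have [I [p [i [ps ii ip]]]] := image_exists f.
apply: (reached_ext (f := i) (g := cprj f)) => //;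
  last exact: reached_quot ps RX.
split=> //; last exact: cprj_surj.
move=> y; rewrite cprjP; split=> [[x <-]|[z <-]]; first by exists (p x).
by have [x <-] := ps z; exists x; rewrite ip.
Qed.

(** A counterexample of least weight is simple in the heart, as a proper subobject would build it
    from two objects of smaller weight; but a simple object in [T] is a quotient of [S]. *)
Lemma reached_all S : T S ->
  (forall X, Tsimple T F X -> exists f : {linear S -> X}, nonzero_map f) ->
  forall Z, T Z -> reached_from S Z.
Proof.
move=> TS hS Z TZ; apply: contrapT => nZ.
have [|X [[TX nX] Xmin]] := @min_measure _ A (fun X => `|w X|%N)
    (fun X => T X /\ ~ reached_from S X); first by exists Z.
have small B : T B -> w B < w X -> reached_from S B.
  move=> TB lt; apply: contrapT => nB.
  have : (`|w X| <= `|w B|)%N by apply: Xmin.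
  by have := weight_T wA wT TB; lia.
have sX : Tsimple T F X.
  split=> // [X0|B f TB FK [b fb]].
    by apply: nX => N p ps nN; case: nN => n; have [x <-] := ps n;
      rewrite (X0 x) raddf0.
  apply: contrapT => nb.
  have TC : T (cokm f) := tp_quot tp (@cprj_surj _ _ _ _ f) TX.
  have lt : w (kerm f) < w (cokm f).
    by rewrite ltNge; apply/negP => h; apply: nb; apply: (weight_bij wA wT wF).
  have wB : 0 < w B by apply: wT => // B0; apply: fb; rewrite (B0 b) raddf0.
  have wf := additive_map wA f; have wK := weight_F wA wF FK.
  have wC := weight_T wA wT TC.
  by apply: nX; apply: (reached_map (f := f)); apply: small => //; lia.
have [f nf] := hS X sX; have [fs _] := Tsimple_strong tp sX TS nf.
apply: nX; apply: (reached_quot fs) => N p ps nN; exists p.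
have [n nn] := not_zeroP nN; have [x xE] := ps n.
by exists x; rewrite xE.
Qed.

(** The image of a nonzero map [S -> S'] receives a nonzero map from [S']; the resulting
    endomorphism of the brick [S'] is invertible, so the image is everything. *)
Lemma reached_brick_surj S S' : brick S' -> T S' -> reached_from S S' ->
  (forall Z, T Z -> reached_from S' Z) -> T S ->
  exists f : {linear S -> S'}, surjective f.
Proof.
move=> [nS' bS'] TS' R R' TS; have [idS idE] := id_exists S'.
have [|f [s fs]] := R _ idS _ nS'; first by move=> x; exists x.
have [I [p [i [ps ii ip]]]] := image_exists f.
have nI : ~ is_zero I by move=> I0; apply: fs; rewrite -ip (I0 (p s)) raddf0.
have TI := tp_quot tp ps TS; have [idI idIE] := id_exists I.
have [|h [s' hs']] := R' I TI _ idI _ nI; first by move=> x; exists x.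
have [ih ihE] := comp_exists i h.
have ihb : bijective ih.
  by apply: bS'; exists s'; rewrite ihE => /(inj_eq0 ii).
have is_ : surjective i.
  by move=> y; have [x <-] := bij_surj ihb y; exists (h x); rewrite ihE.
exists f => y; have [z <-] := is_ y; have [x <-] := ps z.
by exists x; rewrite ip.
Qed.

Lemma generating_brick_unique S S' : brick S -> brick S' -> T S -> T S' ->
  (forall X, Tsimple T F X -> exists f : {linear S -> X}, nonzero_map f) ->
  (forall X, Tsimple T F X -> exists f : {linear S' -> X}, nonzero_map f) ->
  iso S S'.
Proof.
move=> bS bS' TS TS' hS hS'.
have R := reached_all TS hS; have R' := reached_all TS' hS'.
have [f fs] := reached_brick_surj bS' TS' (R _ TS') R' TS.
have [g gs] := reached_brick_surj bS TS (R' _ TS) R TS'.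
exists f; apply: bij_injsurj => //; apply: (surj_dim_inj fs).
by rewrite (mdim_surj gs) leq_addl.
Qed.
End BricksGenerating.

(** * Induction over chambers *)

Section Main.
Variables (R : realType) (k : fieldType) (A : falgType k).
Implicit Types X Y Z M N L E Q I K C D W B S : fgmod A.

Lemma realify_additive (w : fgmod A -> int) : ses_additive w ->
  forall X Y Z (f : {linear X -> Y}) (g : {linear Y -> Z}), short_exact f g ->
  (w Y)%:~R = (w X)%:~R + (w Z)%:~R :> R.
Proof. by move=> wA X Y Z f g /wA ->; rewrite rmorphD. Qed.

Definition realify w (wA : ses_additive w) : K0dual R A :=
  K0Dual (realify_additive wA).

Lemma Ttors_realify w (wA : ses_additive w) X : nT w X <-> Ttors (realify wA) X.
Proof.
rewrite TtorsP; split=> h N p ps nN; have := h N p ps nN; rewrite /= ?ltr0z //.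
Qed.

Lemma Ftors_realify w (wA : ses_additive w) X : nF w X <-> Ftors (realify wA) X.
Proof.
rewrite FtorsP; split=> h N p ps nN; have := h N p ps nN; rewrite /= ?ltrz0 //.
Qed.

Variable M : fgmod A.
Hypothesis MTF_TF : forall theta eta : K0dual R A,
  MTF_equiv M theta eta -> TF_equiv theta eta.

Definition chamber (T F : fgmod A -> Prop) (w : fgmod A -> int) :=
  [/\ torsion_pair T F, ses_additive w, forall X, T X -> ~ is_zero X ->
    0 < w X &
      forall X, F X -> ~ is_zero X -> w X < 0].

Lemma chamber_T T F w : chamber T F w -> forall X, T X -> nT w X.
Proof. by move=> [tp _ wT _] X TX N p ps; apply: wT; apply: (tp_quot tp ps).
Qed.

Lemma chamber_F T F w : chamber T F w -> forall X, F X -> nF w X.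
Proof. by move=> [tp _ _ wF] X TX N p ps; apply: wF; apply: (tp_sub tp ps). Qed.

(* For [m] large the functionals [beyond_wall m] are all [M]-TF equivalent,
   hence TF equivalent, so that one value of [m] works for all objects. *)
Lemma mutated_chamber T F w n V e g X0 j0 : chamber T F w ->
  @dual_basis k A T F n V e g -> Tsimple T F X0 -> iso X0 (V j0) -> e j0 ->
  exists w', chamber (mut_T w X0 (g j0)) (mut_F w X0 (g j0)) w'.
Proof.
move=> [tp wA wT wF] db sX iX ej.
have gA := db_additive db j0.
have eA := wall_additive wA X0 gA.
have tp1 := torsion_pair_T_Fb eA.
have bwA m : ses_additive (beyond_wall w g X0 j0 m).
  exact: (beyond_wall_additive wA db iX ej).
have hT Z : mut_T w X0 (g j0) Z -> exists m0, forall m, (m0 <= m)%N ->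
    Ttors (realify (bwA m)) Z.
  move=> /(beyond_wall_T db iX ej)[m0 h]; exists m0 => m hm.
  exact/Ttors_realify/h.
have hF Z : mut_F w X0 (g j0) Z -> exists m0, forall m, (m0 <= m)%N ->
    Ftors (realify (bwA m)) Z.
  move=> /(beyond_wall_F tp wA wT wF db sX iX ej)[m0 h]; exists m0 => m hm.
  exact/Ftors_realify/h.
have [L [N [i [p [ip TL FN]]]]] := tp_dec tp1 M.
have [m1 h1] := hT _ TL; have [m2 h2] := hF _ FN.
pose m0 := maxn m1 m2.
have TF m : (m0 <= m)%N -> TF_equiv (realify (bwA m)) (realify (bwA m0)).
  move=> hm; apply: MTF_TF; apply: (MTF_of_common_torsion ip).
  - by apply: h1; apply: leq_trans hm; rewrite leq_maxl.
  - by apply: h2; apply: leq_trans hm; rewrite leq_maxr.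
  - by apply: h1; rewrite leq_maxl.
  - by apply: h2; rewrite leq_maxr.
exists (beyond_wall w g X0 j0 m0); split=> // X HX nX.
  (* [X] has a threshold [m] of its own; at [maxn m0 m] it is torsion, and TF equivalence carries
     this back to [m0]. *)
  have [m hm] := hT _ HX; have [_ _ h _] := TF (maxn m0 m) (leq_maxl _ _) X.
  have /h/Ttors_realify hX := hm _ (leq_maxr m0 m).
  have [f fE] := id_exists X; apply: (hX X f) => // x; by exists x.
have [m hm] := hF _ HX; have [_ h _ _] := TF (maxn m0 m) (leq_maxl _ _) X.
have /h/Ftors_realify hX := hm _ (leq_maxr m0 m).
by have [f fE] := id_exists X; apply: (hX X f) => // x y; rewrite !fE.
Qed.

Lemma chamber_bricks_fin d T F w n V e g : chamber T F w ->
  @dual_basis k A T F n V e g ->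
  (forall L N (i : {linear L -> M}) (p : {linear M -> N}),
     short_exact i p -> T L -> F N -> (mdim L < d)%N) ->
  fin_classes (fun S => brick S /\ T S).
Proof.
elim: d T F w n V e g => [|d IHd] T F w n V e g ch db hd;
  have [tp wA wT wF] := ch.
  by have [L [N [i [p [ip TL FN]]]]] := tp_dec tp M; have :=
    hd _ _ _ _ ip TL FN.
(* Bricks in [T] either map nontrivially to every simple object in [T], as in [G], or have no
   nonzero map to one of index [j], as in [P j], and then lie in a mutated torsion class. *)
pose P j S := [/\ brick S, T S & exists X, [/\ Tsimple T F X, iso X (V j), e j &
  forall f : {linear S -> X}, ~ nonzero_map f]].
pose G S := [/\ brick S, T S &
  forall X, Tsimple T F X -> exists f : {linear S -> X}, nonzero_map f].
have finG : fin_classes G.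
  have [[S [bS TS hS]]|nG] := pselect (exists S, G S); last first.
    by apply: fin_classes0 => S GS; apply: nG; exists S.
  exists 1%N, (fun _ => S) => S' [bS' TS' hS']; exists ord0.
  exact: (generating_brick_unique tp wA wT wF).
have finP j : fin_classes (P j).
  have [[X0 [sX iX ej]]|nX] :=
    pselect (exists X0, [/\ Tsimple T F X0, iso X0 (V j) & e j]); last first.
    by apply: fin_classes0 => S [_ _ [X [sX iX ej _]]]; apply: nX; exists X.
  have [L0 [N0 [i0 [p0 [ip0 TL0 FN0]]]]] := tp_dec tp M.
  have [w' ch'] := mutated_chamber ch db sX iX ej.
  have [V' [e' [g' db']]] := dual_basis_mutation tp wA wT wF db sX iX ej.
  have [tp' _ _ _] := ch'.
  have [|m [B BP]] := IHd _ _ _ _ _ _ _ ch' db'.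
    move=> L N i p ip TL FN; have hL0 := hd _ _ _ _ ip0 TL0 FN0.
    (* Otherwise [L0] would be torsion in the mutated chamber too, making both chambers TF
       equivalent; but [X0] lies in [T] and in the mutated torsion-free class. *)
    rewrite ltnNge; apply/negP => hL.
    have TL' : T L := mutated_T_sub tp wA wT wF db iX ej TL.
    have [i0i ex0 _] := ip0; have [ii _ _] := ip.
    have [q qE] := comp_exists p0 i.
    have [|h hE] := @lift_inj _ _ _ _ _ i0 i i0i.
      by move=> z; apply/ex0; rewrite -qE; apply: (tp_hom tp).
    have hi : injective h by move=> x y e0; apply: ii; rewrite -!hE e0.
    have hs : surjective h by apply: inj_dim_surj => //; apply: leq_trans hL.
    have TL0' := tp_quot tp' hs TL.
    have FN0' := mutated_F_sup tp wA wT wF db iX ej FN0.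
    have [_ wA' _ _] := ch'.
    have : TF_equiv (realify wA) (realify wA').
      apply: MTF_TF; apply: (MTF_of_common_torsion ip0).
      - exact/Ttors_realify/(chamber_T ch).
      - exact/Ftors_realify/(chamber_F ch).
      - exact/Ttors_realify/(chamber_T ch').
      - exact/Ftors_realify/(chamber_F ch').
    move=> /(_ X0)[_ _ TT _]; have [TX nX _] := sX.
    have /TT/Ttors_realify TX' : Ttors (realify wA) X0.
      exact/Ttors_realify/(chamber_T ch).
    have FX' := chamber_F ch' (mutated_F_simple tp wA wT wF db sX iX ej).
    have [f fE] := id_exists X0.
    have : 0 < w' X0 by apply: (TX' X0 f) => // x; exists x.
    have : w' X0 < 0 by apply: (FX' X0 f) => // x y; rewrite !fE.
    lia.
  exists m, B => S [bS TS [X [_ iX' _ hX]]]; apply: BP; split=> //.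
  apply: (mutated_T_orth tp wA wT wF db iX ej TS) => f [s fs].
  have [u ub] := iso_trans iX (iso_sym iX'); have [uf ufE] := comp_exists u f.
  by apply: (hX uf); exists s; rewrite ufE => /(inj_eq0 (bij_inj ub)).
apply: (fin_classesU finG (fin_classes_bigU finP)) => S [bS TS].
have [h|h] := pselect (forall X, Tsimple T F X ->
  exists f : {linear S -> X}, nonzero_map f); first by left.
right; apply: contrapT => nP; apply: h => X sX.
have [j [ej Xj]] := db_T db sX; apply: contrapT => nf; apply: nP; exists j.
by split=> //; exists X; split=> // f nzf; apply: nf; exists f.
Qed.

Lemma module_category_chamber :
  chamber (fun=> True) (@is_zero k A) (fun X => (mdim X)%:Z).
Proof.
split; last by move=> X X0 /(_ X0).
- split=> // [X Y i ii Y0 x|X]; first by apply: ii; rewrite (Y0 (i x)) raddf0.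
  have [f fE] := id_exists X.
  have fs : surjective f by move=> x; exists x; rewrite fE.
  exists X, (cokm f), f, (cprj f); split=> //; last exact/cokm_zero.
  by apply: ses_coker => x y; rewrite !fE.
- exact: mdim_additive.
- by move=> X _ /mdim_gt0.
Qed.

(** For the whole module category the heart is [mod A] itself: all signs are positive, and the
    Jordan-Holder multiplicities are dual to pairwise non-isomorphic simple modules. *)
Lemma simple_dual_basis : exists n V e g,
  @dual_basis k A (fun=> True) (@is_zero k A) n V e g.
Proof.
have [n [V [sV Vinj Vcov]]] := fin_classes_irredundant (@simple_fin k A).
have /choice[g gP] : forall i, exists h : fgmod A -> int, ses_additive h /\
    forall S, simple S -> h S = iso_ind (V i) S.
  by move=> i; apply: multiplicity_exists.
exists n, V, (fun=> true), g; split.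
- by move=> i; apply: (proj1 (gP i)).
- move=> i j; rewrite (proj2 (gP i)) // /iso_ind.
  case: asboolP => [/Vinj ->|nij]; first by rewrite eqxx.
  by case: eqP => // ij; case: nij; rewrite ij; apply: iso_refl.
- move=> X [_ nX sX]; have [|i Xi] := Vcov X; last by exists i.
  split=> // L i ii nL; apply: bij_surj; apply: sX => //; first exact/kerm_zero.
  by have [l nl] := not_zeroP nL; exists l => /(inj_eq0 ii).
- by move=> Y [Y0 /(_ Y0)].
Qed.

Lemma MTF_brick_finite : brick_finite A.
Proof.
have [n [V [e [g db]]]] := simple_dual_basis.
have [|m [B BP]] := chamber_bricks_fin (d :=
  (mdim M).+1) module_category_chamber db.
  by move=> L N i p [ii _ _] _ _; rewrite ltnS (mdim_inj ii) leq_addr.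
by exists m, B => S bS; apply: BP.
Qed.
End Main.

Theorem proposition3p8 (R : realType) (k : fieldType) (A : falgType k) :
  brick_finite A <->
  exists M : fgmod A,
    forall theta eta : K0dual R A, MTF_equiv M theta eta <-> TF_equiv theta eta.
Proof.
split; first exact: brick_finite_MTF.
by move=> [M hM]; apply: (MTF_brick_finite (R := R) (M := M)) => theta eta /hM.
Qed.
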